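(* For a frame $L$, the following statements are equivalent. (1) $L$ is a $P_F$-frame. (2) If $a,b\in \mathrm{Coz}\,L$ are such that $a\wedge b$ is complemented, then at least one of $a,b$ is complemented. (3) Of any two ideals of $\mathcal{R}L$ whose product is a $P$-ideal, at least one is a $P$-ideal. (4) Of any two principal ideals of $\mathcal{R}L$ whose product is zero, at least one is semiprime (and likewise with ''intersection'' in place of ''product''). (5) Of any two principal ideals of $\mathcal{R}L$ whose product is semiprime, at least one is semiprime (and likewise with ''intersection'' in place of ''product''). (6) $L$ is an essential $P$-frame which is also an $F$-frame. Here in (4) and (5) the version with product and the version with intersection are each among the equivalent conditions.
   Context: A frame is a complete lattice $L$ (top $1$, bottom $0$) satisfying $a\wedge\bigvee S=\bigvee\{a\wedge s\mid s\in S\}$ for all $a\in L$, $S\subseteq L$. Throughout, all frames are assumed completely regular: $a=\bigvee\{x\mid x\prec\!\prec a\}$ for all $a$, where $a\prec b$ means there is $t$ with $a\wedge t=0$, $t\vee b=1$, and $a\prec\!\prec b$ means there is a family $(c_q)_{q\in\mathbb{Q}\cap[0,1]}$ with $c_0=a$, $c_1=b$, $c_r\prec c_s$ for $r<s$. An element $a$ is complemented if $a\vee a^*=1$, where $a^*=\bigvee\{x\in L\mid x\wedge a=0\}$. $\mathcal{L}(\mathbb{R})$ is the frame of reals, generated by pairs $(p,q)$ of rationals subject to $(p,q)\wedge(r,s)=(p\vee r,q\wedge s)$; $(p,q)\vee(r,s)=(p,s)$ when $p\le r<q\le s$; $(p,q)=\bigvee\{(r,s)\mid p<r<s<q\}$;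 $1=\bigvee\{(p,q)\mid p,q\in\mathbb{Q}\}$. $\mathcal{R}L$ is the ring of real-valued continuous functions on $L$: the set of frame homomorphisms $\mathcal{L}(\mathbb{R})\to L$, a commutative ring with identity under $(\varphi\diamond\psi)(p,q)=\bigvee\{\varphi(r,s)\wedge\psi(t,u)\mid x\diamond y\in(p,q)\text{ for all rationals }x\in(r,s),\,y\in(t,u)\}$ for $\diamond\in\{+,\cdot\}$. For $\varphi\in\mathcal{R}L$, $\mathrm{coz}\,\varphi=\bigvee\{\varphi(p,0)\vee\varphi(0,q)\mid p,q\in\mathbb{Q}\}$, and $\mathrm{Coz}\,L=\{\mathrm{coz}\,\varphi\mid\varphi\in\mathcal{R}L\}$. $L$ is a $P_F$-frame if whenever $a,b\in\mathrm{Coz}\,L$ satisfy $a\wedge b=0$, at least one of $a,b$ is complemented. $L$ is an essential $P$-frame if at most one $a\in\mathrm{Coz}\,L$ fails to be complemented. An onto frame homomorphism $\pi:L\to M$ is a $C^*$-quotient if every bounded frame homomorphism $g:\mathcal{L}(\mathbb{R})\to M$ (bounded: $g(p,q)=1$ for some $p,q\in\mathbb{Q}$) factors as $g=\pi\tilde g$ for some frame homomorphism $\tilde g:\mathcal{L}(\mathbb{R})\to L$. $L$ is an $F$-frame if for each $a\in\mathrm{Coz}\,L$ the map $L\to\downarrow\! a=\{x\mid x\le a\}$, $x\mapsto a\wedge x$, is a $C^*$-quotient; it is known that this holds if and only if whenever $a,b\in\mathrm{Coz}\,L$ with $a\wedge b=0$ there are $c,d\in\mathrm{Coz}\,L$ with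 $c\vee d=1$ and $c\wedge a=0=d\wedge b$. A proper ideal $I$ of $\mathcal{R}L$ is semiprime if, whenever $J^n\subseteq I$ for an ideal $J$ and a positive integer $n$, then $J\subseteq I$; equivalently, $\alpha^2\in I$ implies $\alpha\in I$. A nonzero ideal $I$ of $\mathcal{R}L$ is a $P$-ideal if every proper prime ideal of $I$ (with $I$ regarded as a ring, possibly without identity) is maximal in $I$; the zero ideal is also counted as a $P$-ideal.
   Formalization: Essential P-frame is taken to mean: if a,b in Coz L and a∨b=1, then a or b is complemented (with ''at most one a in Coz L fails to be complemented'', (1) does not imply (6)); and L is assumed to have 0≠1, since otherwise (4) fails while (1) holds. *)

(* Defs.v *)
From HB Require Import structures.
From mathcomp Require Import all_boot all_order all_algebra.
From mathcomp Require Import boolp classical_sets.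
From mathcomp Require Import ring lra.

Set Implicit Arguments.
Unset Strict Implicit.
Unset Printing Implicit Defensive.

Import Order.TTheory GRing.Theory Num.Theory.

Local Open Scope ring_scope.
Local Open Scope classical_set_scope.
Local Open Scope order_scope.

HB.mixin Record TBDistrLattice_isFrame d L of Order.TBDistrLattice d L := {
  fsup : set L -> L;
  fsup_ub : forall (S : set L) x, S x -> x <= fsup S;
  fsup_le : forall (S : set L) y, (forall x, S x -> x <= y) -> fsup S <= y;
  meet_fsup : forall (a : L) (S : set L),
    a `&` fsup S = fsup [set a `&` s | s in S]
}.

#[short(type="frameType")]
HB.structure Definition Frame d :=
  { L of TBDistrLattice_isFrame d L & Order.TBDistrLattice d L }.

Arguments fsup_ub {d s S x}.
Arguments fsup_le {d s S y}.

(** A frame can be built from a poset with finite meets, arbitrary joins and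
    the (nontrivial half of the) frame law. *)
HB.factory Record POrder_isFrame d L of Order.POrder d L := {
  top : L;
  meet : L -> L -> L;
  sup : set L -> L;
  le_top : forall x, x <= top;
  le_meet : forall x y z, (x <= meet y z) = (x <= y) && (x <= z);
  sup_ub : forall (S : set L) x, S x -> x <= sup S;
  sup_le : forall (S : set L) y, (forall x, S x -> x <= y) -> sup S <= y;
  meet_sup_le : forall (a : L) (S : set L),
    meet a (sup S) <= sup [set meet a s | s in S]
}.

HB.builders Context d L of POrder_isFrame d L.

Let join (x y : L) := sup [set z | z = x \/ z = y].

Let meetl x y : meet x y <= x.
Proof. by have := lexx (meet x y); rewrite le_meet => /andP[]. Qed.

Let meetr x y : meet x y <= y.
Proof. by have := lexx (meet x y); rewrite le_meet => /andP[]. Qed.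

Let le_meetP x y z : x <= y -> x <= z -> x <= meet y z.
Proof. by move=> xy xz; rewrite le_meet xy xz. Qed.

Let joinl x y : x <= join x y.
Proof. by apply: sup_ub; left. Qed.

Let joinr x y : y <= join x y.
Proof. by apply: sup_ub; right. Qed.

Let join_leP x y z : x <= z -> y <= z -> join x y <= z.
Proof. by move=> xz yz; apply: sup_le => w [] ->. Qed.

Let meetC : commutative meet.
Proof. by move=> x y; apply: le_anti; rewrite !le_meetP ?meetl ?meetr. Qed.

Let joinC : commutative join.
Proof. by move=> x y; apply: le_anti; rewrite !join_leP ?joinl ?joinr. Qed.

Let meetA : associative meet.
Proof.
move=> x y z; apply: le_anti; apply/andP; split.
  apply: le_meetP; last exact: le_trans (meetr _ _) (meetr _ _).
  by apply: le_meetP; [exact: meetl | exact: le_trans (meetr _ _) (meetl _ _)].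
apply: le_meetP; first exact: le_trans (meetl _ _) (meetl _ _).
by apply: le_meetP; [exact: le_trans (meetl _ _) (meetr _ _) | exact: meetr].
Qed.

Let joinA : associative join.
Proof.
move=> x y z; apply: le_anti; apply/andP; split.
  apply: join_leP; first exact: le_trans (joinl _ _) (joinl _ _).
  by apply: join_leP; [exact: le_trans (joinr _ _) (joinl _ _) | exact: joinr].
apply: join_leP; last exact: le_trans (joinr _ _) (joinr _ _).
by apply: join_leP; [exact: joinl | exact: le_trans (joinl _ _) (joinr _ _)].
Qed.

Let joinKI y x : meet x (join x y) = x.
Proof. by apply: le_anti; rewrite meetl le_meetP ?joinl. Qed.

Let meetKU y x : join x (meet x y) = x.
Proof. by apply: le_anti; rewrite joinl join_leP ?meetl. Qed.

Let leEmeet x y : (x <= y) = (meet x y == x).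
Proof.
apply/idP/eqP => [xy|<-]; last exact: meetr.
by apply: le_anti; rewrite meetl le_meetP.
Qed.

Let meetUl : left_distributive meet join.
Proof.
move=> x y z; apply: le_anti; apply/andP; split; last first.
  apply: join_leP; apply: le_meetP (meetr _ _); apply: le_trans (meetl _ _) _.
    exact: joinl.
  exact: joinr.
rewrite meetC; apply: le_trans (meet_sup_le _ _) _.
by apply: sup_le => _ [w [] -> <-]; rewrite meetC ?joinl ?joinr.
Qed.

HB.instance Definition _ := Order.POrder_Meet_isDistrLattice.Build d L
  meetC joinC meetA joinA joinKI meetKU leEmeet meetUl.

Let le_bot x : sup set0 <= x. Proof. exact: sup_le. Qed.

HB.instance Definition _ := Order.hasBottom.Build d L le_bot.
HB.instance Definition _ := Order.hasTop.Build d L le_top.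

Let meet_sup (a : L) (S : set L) :
  a `&` sup S = sup [set a `&` s | s in S].
Proof.
apply: le_anti; rewrite meet_sup_le /=.
apply: sup_le => _ [s Ss <-]; apply: le_meetP; first exact: meetl.
exact: le_trans (meetr _ _) (sup_ub Ss).
Qed.

HB.instance Definition _ := TBDistrLattice_isFrame.Build d L
  sup_ub sup_le meet_sup.

HB.end.

Section FrameTheory.
Context {d : Order.disp_t} {L : frameType d}.
Implicit Types (a b x y : L) (S : set L).

Lemma fsup_leP S y : (fsup S <= y) <-> (forall x, S x -> x <= y).
Proof.
split=> [Sy x Sx|]; last exact: fsup_le.
exact: le_trans (fsup_ub Sx) Sy.
Qed.

Lemma fsup_meet_le a S y :
  (forall x, S x -> a `&` x <= y) -> a `&` fsup S <= y.
Proof. by move=> Sy; rewrite meet_fsup; apply: fsup_le => _ [x Sx <-]; exact: Sy. Qed.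

Definition pcompl a : L := fsup [set x | x `&` a = \bot].

Definition complemented a : Prop := a `|` pcompl a = \top.

Definition rather_below a b : Prop :=
  exists t, a `&` t = \bot /\ t `|` b = \top.

Definition completely_below a b : Prop :=
  exists c : rat -> L,
    [/\ c 0%R = a, c 1%R = b &
        forall r s : rat, (0 <= r)%R -> (r < s)%R -> (s <= 1)%R ->
          rather_below (c r) (c s)].

End FrameTheory.

Definition completely_regular d (L : frameType d) : Prop :=
  forall a : L, a = fsup [set x | completely_below x a].

HB.mixin Record isFrameMorphism d (L : frameType d) d' (M : frameType d')
    (f : L -> M) := {
  fmorph1 : f \top = \top;
  fmorphI : {morph f : x y / x `&` y};
  fmorph_sup : forall S : set L, f (fsup S) = fsup (f @` S)
}.

HB.structure Definition FrameMorphism d (L : frameType d) d' (M : frameType d') :=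
  { f of isFrameMorphism d L d' M f }.

Notation "{ 'fmorphism' L -> M }" :=
  (@FrameMorphism.type _ L%type _ M%type) (at level 0, L at level 98,
   M at level 99, format "{ 'fmorphism'  L  ->  M }") : type_scope.

Section FrameMorphismTheory.
Context {d : Order.disp_t} {L : frameType d} {d' : Order.disp_t} {M : frameType d'}.
Implicit Types f g : {fmorphism L -> M}.

Lemma fmorph_ext f g : f =1 g -> f = g.
Proof.
move: f g => [f cf] [g cg] /= /funext fg; rewrite {f}fg in cf *.
congr FrameMorphism.Pack; case: cf cg => [[f1 fI fS]] [[g1 gI gS]].
by rewrite (Prop_irrelevance f1 g1) (Prop_irrelevance fI gI) (Prop_irrelevance fS gS).
Qed.

Lemma fmorph_le f x y : x <= y -> f x <= f y.
Proof. by move/meet_idPl => xy; apply/meet_idPl; rewrite -fmorphI xy. Qed.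

End FrameMorphismTheory.

(** The frame presented by generators [(p, q)] and the four relations is
    realised as the frame of those sets of generators that are closed under the
    relations; [LR_gen p q] is the least such set containing [(p, q)].
    The universal property is [LR_relations_gen], [LR_extend_gen] and
    [LR_hom_ext] below. *)

Record LR_relations d (L : frameType d) (f : rat -> rat -> L) : Prop := {
  LR_meet : forall p q r s : rat,
    f p q `&` f r s = f (Order.max p r) (Order.min q s);
  LR_join : forall p q r s : rat, p <= r -> r < q -> q <= s ->
    f p q `|` f r s = f p s;
  LR_sup : forall p q : rat,
    f p q = fsup [set x | exists r s : rat, [/\ p < r, r < s, s < q & x = f r s]];
  LR_cover : \top = fsup [set x | exists p q : rat, x = f p q]
}.

Record LR_closed (U : set (rat * rat)) : Prop := {
  LR_closed_meet : forall p q r s : rat,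
    U (r, s) -> U (Order.max p r, Order.min q s);
  LR_closed_join : forall p q r s : rat, p <= r -> r < q -> q <= s ->
    U (p, q) -> U (r, s) -> U (p, s);
  LR_closed_sup : forall p q : rat,
    (forall r s : rat, p < r -> r < s -> s < q -> U (r, s)) -> U (p, q)
}.

Definition LR : Type := {U : set (rat * rat) | LR_closed U}.

HB.instance Definition _ := gen_eqMixin LR.
HB.instance Definition _ := gen_choiceMixin LR.

Section FrameOfReals.
Implicit Types (U V W : LR) (S : set LR).

Lemma LR_closed_le (U : set (rat * rat)) : LR_closed U ->
  forall p q r s : rat, U (r, s) -> r <= p -> q <= s -> U (p, q).
Proof.
move=> cU p q r s Urs rp qs; have := LR_closed_meet cU p q Urs.
by rewrite (max_idPl rp) (min_idPl qs).
Qed.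

Definition LR_le U V : bool := `[< sval U `<=` sval V >].

Lemma LR_le_refl : reflexive LR_le.
Proof. by move=> U; apply/asboolP. Qed.

Lemma LR_le_anti : antisymmetric LR_le.
Proof.
move=> [U cU] [V cV] /andP[/asboolP UV /asboolP VU].
by apply: eq_exist; rewrite eqEsubset.
Qed.

Lemma LR_le_trans : transitive LR_le.
Proof.
by move=> V U W /asboolP UV /asboolP VW; apply/asboolP; exact: subset_trans VW.
Qed.

HB.instance Definition _ := Order.Le_isPOrder.Build (Order.Disp tt tt) LR
  LR_le_refl LR_le_anti LR_le_trans.

Lemma LR_leP U V : reflect (sval U `<=` sval V) (U <= V).
Proof. exact: asboolP. Qed.

Lemma LR_top_closed : LR_closed setT.
Proof. by []. Qed.

Lemma LR_meet_closed U V : LR_closed (sval U `&` sval V)%classic.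
Proof.
case: U V => [U cU] [V cV] /=; split.
- by move=> p q r s [Ux Vx]; split; apply: LR_closed_meet.
- move=> p q r s pr rq qs [Ux Vx] [Uy Vy].
  by split; [apply: (LR_closed_join cU) Ux Uy|apply: (LR_closed_join cV) Vx Vy].
- by move=> p q UV; split; apply: LR_closed_sup => // r s pr rs sq;
    have [] := UV r s pr rs sq.
Qed.

Definition LR_closure (A : set (rat * rat)) : set (rat * rat) :=
  [set x | forall B, LR_closed B -> A `<=` B -> B x].

Lemma LR_closure_closed A : LR_closed (LR_closure A).
Proof.
split.
- by move=> p q r s Ax U cU AU; apply: LR_closed_meet => //; exact: Ax.
- move=> p q r s pr rq qs Ax Ay U cU AU.
  by apply: (LR_closed_join cU pr rq qs); [exact: Ax|exact: Ay].
- move=> p q Apq U cU AU; apply: LR_closed_sup => // r s pr rs sq.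
  exact: Apq.
Qed.

Lemma sub_LR_closure A : A `<=` LR_closure A.
Proof. by move=> x Ax U _; exact. Qed.

Definition LR_top : LR := exist _ setT LR_top_closed.
Definition LR_inter U V : LR := exist _ _ (LR_meet_closed U V).
Definition LR_union S : LR :=
  exist _ _ (LR_closure_closed (\bigcup_(U in S) sval U)).

Lemma LR_le_top U : U <= LR_top.
Proof. exact/LR_leP. Qed.

Lemma LR_le_inter U V W : (U <= LR_inter V W) = (U <= V) && (U <= W).
Proof.
apply/idP/andP => [/LR_leP UVW|[/LR_leP UV /LR_leP UW]].
  by split; apply/LR_leP => x /UVW[].
by apply/LR_leP => x Ux; split; [exact: UV|exact: UW].
Qed.

Lemma LR_union_ub S U : S U -> U <= LR_union S.
Proof.
by move=> SU; apply/LR_leP => x Ux; apply: sub_LR_closure; exists U.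
Qed.

Lemma LR_union_le S V : (forall U, S U -> U <= V) -> LR_union S <= V.
Proof.
move=> SV; apply/LR_leP => x; apply; first exact: (svalP V).
by move=> y [U SU Uy]; move/LR_leP: (SV _ SU); exact.
Qed.

Definition imeet (x y : rat * rat) : rat * rat :=
  (Order.max x.1 y.1, Order.min x.2 y.2).

Lemma imeetxx x : imeet x x = x.
Proof. by case: x => p q; rewrite /imeet /= maxxx minxx. Qed.

Lemma LR_imp_closed (U V : set (rat * rat)) : LR_closed V ->
  LR_closed [set x | forall y, U y -> V (imeet x y)].
Proof.
move=> cV; split=> [p q r s UV [a b] Uy|p q r s pr rq qs Ux Uy [a b] Uz|].
- rewrite /imeet /= -maxA -minA; apply: LR_closed_meet => //.
  exact: (UV _ Uy).
- have := Ux _ Uz; have := Uy _ Uz; rewrite /imeet /= => Vy Vx.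
  case: (ltP (Order.max r a) (Order.min q b)) => [lt|].
    apply: (LR_closed_join cV _ lt _ Vx Vy).
      by rewrite ge_max !le_max pr lexx orbT.
    by rewrite le_min !ge_min qs lexx orbT.
  move=> le; case: (leP b a) => [ba|ab].
    apply: LR_closed_sup => // u v; rewrite gt_max lt_min.
    move=> /andP[_ au] uv /andP[_ vb].
    by have := lt_trans au (lt_trans uv vb); rewrite ltNge ba.
  case: (leP q a) => [qa|aq].
    move: Vy; rewrite (max_idPr (le_trans pr (le_trans (ltW rq) qa))).
    by rewrite (max_idPr (le_trans (ltW rq) qa)).
  case: (leP b r) => [br|rb].
    move: Vx; rewrite (min_idPr (le_trans br (le_trans (ltW rq) qs))).
    by rewrite (min_idPr (le_trans br (ltW rq))).
  by move: le; rewrite leNgt gt_max !lt_min rq rb aq ab.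
- move=> p q UV [a b] Uy; apply: LR_closed_sup => // r s; rewrite /imeet /=.
  rewrite gt_max lt_min => /andP[pr ar] rs /andP[sq sb].
  have := UV r s pr rs sq _ Uy; rewrite /imeet /=.
  by rewrite (max_idPl (ltW ar)) (min_idPl (ltW sb)).
Qed.

Lemma LR_inter_union_le U S :
  LR_inter U (LR_union S) <= LR_union [set LR_inter U V | V in S].
Proof.
apply/LR_leP => x [Ux Sx].
have cW := LR_imp_closed (sval U) (svalP (LR_union [set LR_inter U V | V in S])).
rewrite -(imeetxx x); apply: (Sx _ cW) => // {x Ux Sx} x [V SV Vx] y Uy.
case: U V SV Vx Uy cW => [U cU] [V cV] /= SV Vx Uy _.
apply: sub_LR_closure; exists (LR_inter (exist _ U cU) (exist _ V cV)) => /=.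
  by exists (exist _ V cV).
case: x y Vx Uy => [p q] [r s] Vx Uy; split; first exact: (LR_closed_meet cU).
by rewrite /imeet /= maxC minC; exact: (LR_closed_meet cV).
Qed.

HB.instance Definition _ := POrder_isFrame.Build (Order.Disp tt tt) LR
  LR_le_top LR_le_inter LR_union_ub LR_union_le LR_inter_union_le.

Definition LR_gen (p q : rat) : LR :=
  exist _ _ (LR_closure_closed [set (p, q)]).

End FrameOfReals.

Lemma LR_gen_le p q (U : LR) : (LR_gen p q <= U) <-> sval U (p, q).
Proof.
split=> [/LR_leP|Upq]; first by apply; exact: sub_LR_closure.
by apply/LR_leP => x; apply; [exact: (svalP U)|move=> _ ->].
Qed.

Lemma LR_fsup_gen (U : LR) :
  U = fsup [set x | exists p q : rat, sval U (p, q) /\ x = LR_gen p q].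
Proof.
apply: le_anti; apply/andP; split; last first.
  by apply: fsup_le => _ [p [q [Upq ->]]]; exact/LR_gen_le.
apply/LR_leP => -[p q] Upq; apply/LR_gen_le.
by apply: fsup_ub; exists p, q.
Qed.

Lemma LR_gen_leS (p q r s : rat) : p <= r -> s <= q -> LR_gen r s <= LR_gen p q.
Proof.
move=> pr sq; apply/LR_gen_le; apply: LR_closed_le pr sq; first exact: svalP.
exact: sub_LR_closure.
Qed.

Lemma LR_relations_gen : LR_relations LR_gen.
Proof.
split.
- move=> p q r s; apply: le_anti; apply/andP; split; last first.
    by rewrite lexI; apply/andP; split; apply: LR_gen_leS;
       rewrite ?le_max ?ge_min ?lexx ?orbT.
  set W := LR_gen (Order.max p r) _.
  have cW := svalP W.
  have h1 x : sval (LR_gen p q) x -> sval W (imeet x (r, s)).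
    move=> /(_ _ (LR_imp_closed [set (r, s)] cW)); apply => //.
    by move=> _ -> _ ->; exact: sub_LR_closure.
  apply/LR_leP => x [px rx]; rewrite -(imeetxx x).
  apply: (rx _ (LR_imp_closed (sval (LR_gen p q)) cW)) => //.
  by move=> _ -> [a b] /h1; rewrite /imeet /= [Order.max a r]maxC [Order.min b s]minC.
- move=> p q r s pr rq qs; apply: le_anti; apply/andP; split.
    rewrite leUx; apply/andP; split; apply: LR_gen_leS => //.
  set W := LR_gen p q `|` _.
  apply/LR_gen_le; apply: (LR_closed_join (svalP W) pr rq qs);
    apply/LR_gen_le; [exact: leUl|exact: leUr].
- move=> p q; apply: le_anti; apply/andP; split; last first.
    apply: fsup_le => _ [r [s [pr rs sq ->]]].
    by apply: LR_gen_leS; exact: ltW.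
  apply/LR_gen_le; apply: LR_closed_sup; first exact: svalP.
  by move=> r s pr rs sq; apply/LR_gen_le; apply: fsup_ub; exists r, s.
- apply: le_anti; rewrite lex1 andbT [X in X <= _]LR_fsup_gen.
  apply: fsup_le => _ [p [q [_ ->]]].
  by apply: fsup_ub; exists p, q.
Qed.

Section Universal.
Context {d : Order.disp_t} {L : frameType d}.
Implicit Types (U V : LR) (phi psi : {fmorphism LR -> L}).

Lemma LR_hom_ext phi psi :
  (forall p q : rat, phi (LR_gen p q) = psi (LR_gen p q)) -> phi = psi.
Proof.
move=> e; apply: fmorph_ext => U; rewrite (LR_fsup_gen U) !fmorph_sup.
by congr fsup; rewrite eqEsubset; split=> _ [_ [p [q [Upq ->]]] <-];
   exists (LR_gen p q); rewrite ?e //; exists p, q.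
Qed.

Lemma LR_relations_hom phi : LR_relations (fun p q => phi (LR_gen p q)).
Proof.
have [gm gj gs gc] := LR_relations_gen.
split.
- by move=> p q r s; rewrite -fmorphI gm.
- move=> p q r s pr rq qs; rewrite -(gj p q r s pr rq qs).
  apply: le_anti; apply/andP; split.
    by rewrite leUx !fmorph_le ?leUl ?leUr.
  have -> : LR_gen p q `|` LR_gen r s =
     fsup [set x | x = LR_gen p q \/ x = LR_gen r s].
    apply: le_anti; apply/andP; split.
      by rewrite leUx; apply/andP; split; apply: fsup_ub; [left|right].
    by apply: fsup_le => _ [->|->]; rewrite ?leUl ?leUr.
  by rewrite fmorph_sup; apply: fsup_le => _ [_ [->|->] <-]; rewrite ?leUl ?leUr.
- move=> p q; rewrite [in LHS]gs fmorph_sup.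
  congr fsup; rewrite eqEsubset; split.
    by move=> _ [_ [r [s [pr rs sq ->]]] <-]; exists r, s.
  move=> _ [r [s [pr rs sq ->]]]; exists (LR_gen r s) => //; by exists r, s.
- rewrite -(@fmorph1 _ _ _ _ phi) gc fmorph_sup; congr fsup; rewrite eqEsubset; split.
    by move=> _ [_ [p [q ->]] <-]; exists p, q.
  by move=> _ [p [q ->]]; exists (LR_gen p q) => //; exists p, q.
Qed.

Variables (f : rat -> rat -> L) (Hf : LR_relations f).

Lemma LR_relations_le (p q r s : rat) : p <= r -> s <= q -> f r s <= f p q.
Proof.
move=> pr sq; rewrite -(max_idPl pr) -(min_idPr sq).
by rewrite maxC -(LR_meet Hf) leIl.
Qed.

Lemma LR_ideal_closed (y : L) : LR_closed [set x | f x.1 x.2 <= y].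
Proof.
split => /=.
- move=> p q r s; apply: le_trans; rewrite -(LR_meet Hf); exact: leIr.
- by move=> p q r s pr rq qs fx fy; rewrite -(LR_join Hf pr rq qs) leUx fx.
- move=> p q h; rewrite (LR_sup Hf); apply: fsup_le => _ [r [s [pr rs sq ->]]].
  exact: h.
Qed.

Definition LR_extend_fun U : L :=
  fsup [set y | exists p q : rat, sval U (p, q) /\ y = f p q].

Lemma LR_extend_le U y :
  (forall p q : rat, sval U (p, q) -> f p q <= y) -> LR_extend_fun U <= y.
Proof. by move=> Uy; apply: fsup_le => _ [p [q [Upq ->]]]; exact: Uy. Qed.

Lemma LR_extend_ub U p q : sval U (p, q) -> f p q <= LR_extend_fun U.
Proof. by move=> Upq; apply: fsup_ub; exists p, q. Qed.

Lemma LR_extend1 : LR_extend_fun \top = \top.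
Proof.
by apply: le_anti; rewrite lex1 (LR_cover Hf) /=; apply: fsup_le => _ [p [q ->]];
   exact: LR_extend_ub.
Qed.

Lemma LR_extendI : {morph LR_extend_fun : x y / x `&` y}.
Proof.
move=> U V; apply: le_anti; apply/andP; split.
  by apply: LR_extend_le => p q [Ux Vx]; rewrite lexI !LR_extend_ub.
apply: fsup_meet_le => _ [r [s [Vrs ->]]]; rewrite meetC.
apply: fsup_meet_le => _ [p [q [Upq ->]]]; rewrite (LR_meet Hf).
apply: LR_extend_ub; split; last first.
  by rewrite maxC minC; apply: LR_closed_meet => //; exact: svalP.
by apply: LR_closed_meet => //; exact: svalP.
Qed.

Lemma LR_extend_sup S : LR_extend_fun (fsup S) = fsup (LR_extend_fun @` S).
Proof.
apply: le_anti; apply/andP; split.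
  apply: LR_extend_le => p q /(_ _ (LR_ideal_closed _)); apply.
  move=> -[r s] [U SU Urs] /=; apply: le_trans (LR_extend_ub Urs) _.
  by apply: fsup_ub; exists U.
apply: fsup_le => _ [U SU <-]; apply: LR_extend_le => p q Upq.
by apply: LR_extend_ub; apply: sub_LR_closure; exists U.
Qed.

HB.instance Definition _ := isFrameMorphism.Build _ _ _ _ LR_extend_fun
  LR_extend1 LR_extendI LR_extend_sup.

Definition LR_extend : {fmorphism LR -> L} := LR_extend_fun.

Lemma LR_extend_gen p q : LR_extend (LR_gen p q) = f p q.
Proof.
apply: le_anti; apply/andP; split; last by apply: LR_extend_ub; exact: sub_LR_closure.
apply: LR_extend_le => r s /(_ _ (LR_ideal_closed _)); apply.
by move=> _ -> /=.
Qed.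

End Universal.

Definition RL d (L : frameType d) : Type := {fmorphism LR -> L}.

Section RingOfFunctions.
Context {d : Order.disp_t} {L : frameType d}.
Implicit Types (phi psi chi : RL L) (w v : L) (p q r s : rat).

HB.instance Definition _ := gen_eqMixin (RL L).
HB.instance Definition _ := gen_choiceMixin (RL L).

Definition bounded phi : Prop := exists p q : rat, phi (LR_gen p q) = \top.

Definition coz phi : L :=
  fsup [set x | exists p q : rat, x = phi (LR_gen p 0) `|` phi (LR_gen 0 q)].

Lemma RL_meet phi p q r s : phi (LR_gen p q) `&` phi (LR_gen r s) =
  phi (LR_gen (Order.max p r) (Order.min q s)).
Proof. exact: (LR_meet (LR_relations_hom phi)). Qed.

Lemma RL_join phi p q r s : p <= r -> r < q -> q <= s ->
  phi (LR_gen p q) `|` phi (LR_gen r s) = phi (LR_gen p s).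
Proof. exact: (LR_join (LR_relations_hom phi)). Qed.

Lemma RL_sup phi p q : phi (LR_gen p q) =
  fsup [set x | exists r s : rat, [/\ p < r, r < s, s < q & x = phi (LR_gen r s)]].
Proof. exact: (LR_sup (LR_relations_hom phi)). Qed.

Lemma RL_cover phi : \top = fsup [set x | exists p q : rat, x = phi (LR_gen p q)].
Proof. exact: (LR_cover (LR_relations_hom phi)). Qed.

Let RL_le phi p q r s : p <= r -> s <= q -> phi (LR_gen r s) <= phi (LR_gen p q).
Proof. exact: LR_relations_le (LR_relations_hom phi) _ _ _ _. Qed.

Let RL_empty phi p q : q <= p -> phi (LR_gen p q) = \bot.
Proof.
move=> qp; apply: le_anti; rewrite le0x andbT (RL_sup phi).
apply: fsup_le => x [r [s [pr rs sq _]]].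
by have := lt_trans pr (lt_trans rs sq); rewrite ltNge qp.
Qed.

Lemma fsup_meet2_le (S T : set L) v :
  (forall x y, S x -> T y -> x `&` y <= v) -> fsup S `&` fsup T <= v.
Proof.
move=> h; apply: fsup_meet_le => y Ty; rewrite meetC.
by apply: fsup_meet_le => x Sx; rewrite meetC; exact: h.
Qed.

Let RL_small phi (e : rat) p q : 0 < e ->
  phi (LR_gen p q) <= fsup [set x | exists r s : rat,
    [/\ p <= r, s <= q, s - r < e & x = phi (LR_gen r s)]].
Proof.
move=> e0; have [n hn] : exists n : nat, q - p < n%:R * (e / 4%:R).
  have e4 : 0 < e / 4%:R by rewrite divr_gt0.
  exists (Num.bound `|(q - p) / (e / 4%:R)|); rewrite -ltr_pdivrMr //.
  by apply: le_lt_trans (ler_norm _) _; exact: archi_boundP (normr_ge0 _).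
elim: n p q hn => [|n IH] p q hn.
  apply: fsup_ub; exists p, q; split => //.
  by rewrite mul0r in hn; exact: lt_trans hn e0.
case: (ltP (q - p) e) => [lt|le].
  by apply: fsup_ub; exists p, q; split.
have [h1 h2 h3] : [/\ p <= p + e / 4%:R, p + e / 4%:R < p + e / 2%:R
    & p + e / 2%:R <= q] by split; lra.
rewrite -(RL_join phi h1 h2 h3).
rewrite leUx; apply/andP; split.
  apply: fsup_ub; exists p, (p + e / 2%:R); split => //; lra.
apply: le_trans (IH _ _ _) _.
  rewrite -natr1 in hn; lra.
apply: fsup_le => _ [r [s [pr sq sr ->]]]; apply: fsup_ub; exists r, s; split => //; lra.
Qed.

Let RL_cover_small phi (e : rat) : 0 < e ->
  \top <= fsup [set x | exists r s : rat, s - r < e /\ x = phi (LR_gen r s)].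
Proof.
move=> e0; rewrite (RL_cover phi).
apply: fsup_le => _ [p [q ->]]; apply: le_trans (RL_small phi p q e0) _.
apply: fsup_le => _ [r [s [_ _ sr ->]]]; apply: fsup_ub; by exists r, s.
Qed.

Let RL_pt2 phi w p q r s : w <= phi (LR_gen p q) -> w <= phi (LR_gen r s) ->
  (forall x : rat, p < x -> x < q -> r < x -> x < s -> w <= \bot) -> w <= \bot.
Proof.
move=> w1 w2 h; have : w <= phi (LR_gen (Order.max p r) (Order.min q s)).
  by rewrite -(RL_meet phi) lexI w1.
case: (ltP (Order.max p r) (Order.min q s)) => [lt _|le]; last first.
  by rewrite RL_empty.
have := midf_lt lt.
set x := _ / _; rewrite gt_max lt_min => -[/andP[px rx] /andP[xq xs]].
exact: (h x).
Qed.

Let RL_pt3 phi w p q r s t u : w <= phi (LR_gen p q) ->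
  w <= phi (LR_gen r s) -> w <= phi (LR_gen t u) ->
  (forall x : rat, p < x -> x < q -> r < x -> x < s -> t < x -> x < u -> w <= \bot) ->
  w <= \bot.
Proof.
move=> w1 w2 w3 h; have w12 : w <= phi (LR_gen (Order.max p r) (Order.min q s)).
  by rewrite -(RL_meet phi) lexI w1.
apply: (RL_pt2 w12 w3) => x; rewrite gt_max lt_min => /andP[? ?] /andP[? ?] ? ?.
exact: (h x).
Qed.

Let RL_eqP phi psi :
  (forall w (p q r s : rat), w <= phi (LR_gen p q) -> w <= psi (LR_gen r s) ->
    (forall x : rat, p < x -> x < q -> r < x -> x < s -> False) -> w <= \bot) ->
  phi = psi.
Proof.
have key (f g : RL L) :
    (forall w (p q r s : rat), w <= f (LR_gen p q) -> w <= g (LR_gen r s) ->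
    (forall x : rat, p < x -> x < q -> r < x -> x < s -> False) -> w <= \bot) ->
    forall p q, f (LR_gen p q) <= g (LR_gen p q).
  move=> h p q; rewrite [in leLHS](RL_sup f).
  apply: fsup_le => _ [r [s [pr rs sq ->]]].
  rewrite -[leLHS]meetx1.
  have e0 : 0 < Order.min (r - p) (q - s) by rewrite lt_min !subr_gt0 pr sq.
  apply: le_trans (leI2 (lexx _) (RL_cover_small g e0)) _.
  apply: fsup_meet_le => _ [u [v [vu ->]]].
  move: vu; rewrite lt_min => /andP[vu1 vu2].
  have [[x [rx xs ux xv]]|no] :=
      pselect (exists x, [/\ r < x, x < s, u < x & x < v]).
    apply: le_trans (leIr _ _) _; apply: RL_le; lra.
  apply: le_trans (le0x _); apply: h (leIl _ _) (leIr _ _) _ => x rx xs ux xv.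
  by apply: no; exists x.
move=> h; apply: LR_hom_ext => p q; apply: le_anti; apply/andP; split.
  exact: key.
apply: key => w a b r s h1 h2 h3; apply: (h w _ _ _ _ h2 h1) => x ? ? ? ?.
exact: (h3 x).
Qed.

Definition in_box (o : rat -> rat -> rat) (r s t u p q : rat) : Prop :=
  forall x y : rat, r < x -> x < s -> t < y -> y < u -> p < o x y /\ o x y < q.

Definition RL_op_gen (o : rat -> rat -> rat) phi psi (p q : rat) : L :=
  fsup [set w | exists r s t u, in_box o r s t u p q /\
                  w = phi (LR_gen r s) `&` psi (LR_gen t u)].

(** Enough conditions on [o] for [RL_op_gen o] to respect the relations. *)
Record liftable (o : rat -> rat -> rat) : Prop := {
  lift_l : forall a b x y : rat, a <= x -> x <= b ->
    Order.min (o a y) (o b y) <= o x y /\ o x y <= Order.max (o a y) (o b y);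
  lift_r : forall a b x y : rat, a <= x -> x <= b ->
    Order.min (o y a) (o y b) <= o y x /\ o y x <= Order.max (o y a) (o y b);
  lift_unif : forall M e : rat, 0 < e -> exists dl : rat, 0 < dl /\
    forall x y x' y' : rat, `|x| <= M -> `|y'| <= M -> `|x - x'| < dl ->
      `|y - y'| < dl -> `|o x y - o x' y'| < e
}.

Lemma liftable_add : liftable +%R.
Proof.
split=> [a b x y ax xb|a b x y ax xb|M e e0].
- by rewrite ge_min le_max; split; apply/orP; [left|right]; lra.
- by rewrite ge_min le_max; split; apply/orP; [left|right]; lra.
- exists (e / 2%:R); split; first lra.
  move=> x y x' y' _ _; rewrite !ltr_norml => /andP[? ?] /andP[? ?].
  by apply/andP; split; lra.
Qed.

Lemma liftable_mul : liftable *%R.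
Proof.
have H (a b x y : rat) : a <= x -> x <= b ->
    Order.min (a * y) (b * y) <= x * y /\ x * y <= Order.max (a * y) (b * y).
  move=> ax xb; rewrite ge_min le_max; case: (leP 0 y) => [y0|/ltW y0].
    by split; apply/orP; [left|right]; rewrite ler_wpM2r.
  by split; apply/orP; [right|left]; rewrite ler_wnM2r.
split=> [//|a b x y ax xb|M e e0].
  by rewrite ![y * _]mulrC; exact: H.
have [M0|M0] := ltP M 0.
  exists 1; split => // x y x' y' /(le_trans (normr_ge0 _)) xM.
  by have := le_lt_trans xM M0; rewrite ltxx.
have k0 : 0 < (2%:R * M + 1)%R by lra.
exists (e / (2%:R * M + 1)); split; first by rewrite divr_gt0.
move=> x y x' y' xM yM dx dy.
have -> : (x * y - x' * y' = x * (y - y') + (x - x') * y')%R by ring.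
apply: le_lt_trans (ler_normD _ _) _; rewrite !normrM.
set dl := (_ / _)%R in dx dy *.
have dl0 : 0 < dl by rewrite divr_gt0.
have -> : e = ((2%:R * M + 1) * dl)%R by rewrite mulrC divfK // gt_eqF.
have h1 : `|x| * `|y - y'| <= M * dl by apply: ler_pM => //; exact: ltW.
have h2 : `|x - x'| * `|y'| <= dl * M by apply: ler_pM => //; exact: ltW.
nra.
Qed.

Section Lift.
Variables (o : rat -> rat -> rat) (Ho : liftable o).

Let lo (r s t u : rat) : rat :=
  Order.min (Order.min (o r t) (o r u)) (Order.min (o s t) (o s u)).
Let hi (r s t u : rat) : rat :=
  Order.max (Order.max (o r t) (o r u)) (Order.max (o s t) (o s u)).

Let o_bounds (r s t u x y : rat) : r <= x -> x <= s -> t <= y -> y <= u ->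
  lo r s t u <= o x y /\ o x y <= hi r s t u.
Proof.
move=> rx xs ty yu; have [l1 h1] := lift_l Ho y rx xs.
have [l2 h2] := lift_r Ho r ty yu; have [l3 h3] := lift_r Ho s ty yu.
split.
  apply: le_trans l1; rewrite le_min; apply/andP; split.
    by apply: le_trans l2; rewrite ge_min lexx.
  by apply: le_trans l3; rewrite ge_min lexx orbT.
apply: le_trans h1 _; rewrite ge_max; apply/andP; split.
  by apply: le_trans h2 _; rewrite le_max lexx.
by apply: le_trans h3 _; rewrite le_max lexx orbT.
Qed.

Let op_ub phi psi p q r s t u : in_box o r s t u p q ->
  phi (LR_gen r s) `&` psi (LR_gen t u) <= RL_op_gen o phi psi p q.
Proof. by move=> b; apply: fsup_ub; exists r, s, t, u. Qed.

Let op_mono phi psi p q p' q' : p' <= p -> q <= q' ->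
  RL_op_gen o phi psi p q <= RL_op_gen o phi psi p' q'.
Proof.
move=> pp qq; apply: fsup_le => _ [r [s [t [u [b ->]]]]].
apply: op_ub => x y rx xs ty yu; have [h1 h2] := b x y rx xs ty yu.
by split; [exact: le_lt_trans pp h1|exact: lt_le_trans h2 qq].
Qed.

Lemma RL_op_relations phi psi : LR_relations (RL_op_gen o phi psi).
Proof.
split.
- move=> p q p' q'; apply: le_anti; apply/andP; split; last first.
    by rewrite lexI; apply/andP; split; apply: op_mono;
       rewrite ?le_max ?ge_min lexx ?orbT.
  apply: fsup_meet2_le => _ _ [r [s [t [u [b ->]]]]] [r' [s' [t' [u' [b' ->]]]]].
  rewrite meetACA !RL_meet; apply: op_ub => x y.
  rewrite !gt_max !lt_min.
  move=> /andP[rx rx'] /andP[xs xs'] /andP[ty ty'] /andP[yu yu'].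
  have [h1 h2] := b x y rx xs ty yu; have [h3 h4] := b' x y rx' xs' ty' yu'.
  by rewrite h1 h2 h3 h4.
- move=> p q p' q' pp pq qq; apply: le_anti; apply/andP; split.
    by rewrite leUx !op_mono // ?(le_trans _ qq) //.
  apply: fsup_le => _ [r [s [t [u [b ->]]]]].
  pose M : rat := `|r| + `|s| + `|t| + `|u|.
  have e0 : 0 < q - p' by rewrite subr_gt0.
  have [dl [dl0 unif]] := lift_unif Ho M e0.
  apply: le_trans (leI2 (RL_small phi _ _ dl0) (RL_small psi _ _ dl0)) _.
  apply: fsup_meet2_le => _ _ [r1 [s1 [rr ss rs ->]]] [t1 [u1 [tt uu tu ->]]].
  have Mb (a c x : rat) : a <= x -> x <= c -> `|x| <= `|a| + `|c|.
    move=> ax xc; rewrite ler_norml; have := ler_norm c; have := ler_norm (- a).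
    rewrite normrN; have := normr_ge0 a; have := normr_ge0 c.
    by move=> *; apply/andP; split; lra.
  have near x y x' y' : r1 < x -> x < s1 -> t1 < y -> y < u1 ->
      r1 < x' -> x' < s1 -> t1 < y' -> y' < u1 -> o x y - o x' y' < q - p'.
    move=> h1 h2 h3 h4 h5 h6 h7 h8; apply: le_lt_trans (ler_norm _) _.
    have := normr_ge0 r; have := normr_ge0 s; have := normr_ge0 t.
    have := normr_ge0 u => n1 n2 n3 n4.
    apply: unif.
    - have : `|x| <= `|r| + `|s| by apply: Mb; lra.
      rewrite /M; lra.
    - have : `|y'| <= `|t| + `|u| by apply: Mb; lra.
      rewrite /M; lra.
    - by rewrite ltr_norml; apply/andP; split; lra.
    - by rewrite ltr_norml; apply/andP; split; lra.
  have [[x [y [h1 h2 h3 h4 h5]]]|no] := pselect (exists x y : rat,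
      [/\ r1 < x, x < s1, t1 < y, y < u1 & o x y <= p']).
    apply: le_trans (leUl _ _); apply: op_ub => x' y' k1 k2 k3 k4.
    have := near x' y' x y k1 k2 k3 k4 h1 h2 h3 h4 => n1.
    have [b1 b2] : p < o x' y' /\ o x' y' < q' by apply: b; lra.
    by split; lra.
  apply: le_trans (leUr _ _); apply: op_ub => x y k1 k2 k3 k4.
  have [b1 b2] : p < o x y /\ o x y < q' by apply: b; lra.
  split => //; rewrite ltNge; apply/negP => le; apply: no.
  by exists x, y.
- move=> p q; apply: le_anti; apply/andP; split; last first.
    by apply: fsup_le => _ [r [s [pr rs sq ->]]]; apply: op_mono; exact: ltW.
  apply: fsup_le => _ [r [s [t [u [b ->]]]]]; rewrite RL_sup (RL_sup psi).
  apply: fsup_meet2_le => _ _ [r1 [s1 [rr rs ss ->]]] [t1 [u1 [tt tu uu ->]]].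
  have [b1 b2] : p < lo r1 s1 t1 u1 /\ hi r1 s1 t1 u1 < q.
    have [b1 b1'] : p < o r1 t1 /\ o r1 t1 < q by apply: b; lra.
    have [b2 b2'] : p < o r1 u1 /\ o r1 u1 < q by apply: b; lra.
    have [b3 b3'] : p < o s1 t1 /\ o s1 t1 < q by apply: b; lra.
    have [b4 b4'] : p < o s1 u1 /\ o s1 u1 < q by apply: b; lra.
    by rewrite !lt_min !gt_max b1 b2 b3 b4 b1' b2' b3' b4'.
  have b3 : lo r1 s1 t1 u1 <= hi r1 s1 t1 u1.
    have [|||h1 h2] := @o_bounds r1 s1 t1 u1 r1 t1 (lexx _); [lra|lra|lra|].
    exact: le_trans h1 h2.
  pose p' := (p + lo r1 s1 t1 u1) / 2%:R.
  pose q' := (hi r1 s1 t1 u1 + q) / 2%:R.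
  apply: (@le_trans _ _ (RL_op_gen o phi psi p' q')); last first.
    by apply: fsup_ub; exists p', q'; rewrite /p' /q'; split => //; lra.
  apply: op_ub => x y h1 h2 h3 h4.
  have [k1 k2] : lo r1 s1 t1 u1 <= o x y /\ o x y <= hi r1 s1 t1 u1.
  by apply: o_bounds; lra.
  by rewrite /p' /q'; split; lra.
- apply: le_anti; rewrite lex1 andbT -[leLHS]meetxx [X in X `&` _](RL_cover phi).
  rewrite (RL_cover psi).
  apply: fsup_meet2_le => _ _ [r [s ->]] [t [u ->]].
  apply: (@le_trans _ _ (RL_op_gen o phi psi (lo r s t u - 1) (hi r s t u + 1))).
    apply: op_ub => x y h1 h2 h3 h4.
    have [k1 k2] : lo r s t u <= o x y /\ o x y <= hi r s t u.
  by apply: o_bounds; lra.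
    by split; lra.
  by apply: fsup_ub; do 2!eexists.
Qed.

Definition RL_op phi psi : RL L := LR_extend (RL_op_relations phi psi).

Lemma RL_opE phi psi p q : RL_op phi psi (LR_gen p q) = RL_op_gen o phi psi p q.
Proof. exact: LR_extend_gen. Qed.

Lemma RL_op_elim w v phi psi p q : w <= RL_op phi psi (LR_gen p q) ->
  (forall w' (r s t u : rat), w' <= w -> w' <= phi (LR_gen r s) ->
     w' <= psi (LR_gen t u) -> in_box o r s t u p q -> w' <= v) -> w <= v.
Proof.
rewrite RL_opE => /meet_idPl e h; rewrite -e; apply: fsup_meet_le => _ [r [s [t [u [b ->]]]]].
apply: (h _ r s t u) => //; first exact: leIl.
  exact: le_trans (leIr _ _) (leIl _ _).
exact: le_trans (leIr _ _) (leIr _ _).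
Qed.

End Lift.

Definition RL_const_gen (c p q : rat) : L :=
  if (p < c) && (c < q) then \top else \bot.

Lemma RL_const_relations c : LR_relations (RL_const_gen c).
Proof.
rewrite /RL_const_gen; split.
- move=> p q r s; rewrite gt_max lt_min.
  by case: (p < c); case: (r < c); case: (c < q); case: (c < s);
     rewrite /= ?meetx1 ?meet1x ?meetx0 ?meet0x.
- move=> p q r s pr rq qs.
  case: (ltP r c) => [rc|cr]; case: (ltP c q) => [cq|qc] /=.
  + by rewrite (le_lt_trans pr rc) (lt_le_trans cq qs) /= joinx1.
  + by rewrite (le_lt_trans pr rc) andbF join0x.
  + by rewrite joinx0 (lt_le_trans cq qs).
  + by have := lt_le_trans rq (le_trans qc cr); rewrite ltxx.
- move=> p q; apply: le_anti; apply/andP; split; last first.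
    apply: fsup_le => _ [r [s [pr rs sq ->]]]; case: andP => // -[rc cs].
    by rewrite (lt_trans pr rc) (lt_trans cs sq).
  case: andP => [[pc cq]|//]; apply: fsup_ub; exists ((p + c) / 2%:R), ((c + q) / 2%:R).
  by split; rewrite ?ifT //; try apply/andP; try split; lra.
- apply: le_anti; rewrite lex1 andbT; apply: fsup_ub; exists (c - 1), (c + 1).
  by rewrite ifT //; apply/andP; split; lra.
Qed.

Definition RL_const c : RL L := LR_extend (RL_const_relations c).

Lemma RL_constE c p q :
  RL_const c (LR_gen p q) = if (p < c) && (c < q) then \top else \bot.
Proof. exact: LR_extend_gen. Qed.

Lemma RL_const_elim w v c p q : w <= RL_const c (LR_gen p q) ->
  (p < c -> c < q -> w <= v) -> w <= v.
Proof.
rewrite RL_constE; case: andP => [[pc cq] _ h|_ w0 _]; first exact: h.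
exact: le_trans w0 (le0x _).
Qed.

Definition RL_opp_gen phi p q : L := phi (LR_gen (- q) (- p)).

Lemma RL_opp_relations phi : LR_relations (RL_opp_gen phi).
Proof.
rewrite /RL_opp_gen; split.
- by move=> p q r s; rewrite RL_meet oppr_max oppr_min.
- by move=> p q r s pr rq qs; rewrite joinC RL_join ?lerN2 ?ltrN2.
- move=> p q; rewrite RL_sup; congr fsup; rewrite eqEsubset; split.
    move=> _ [r [s [pr rs sq ->]]]; exists (- s), (- r).
    by rewrite !opprK; split => //; lra.
  move=> _ [r [s [pr rs sq ->]]]; exists (- s), (- r).
  by split => //; lra.
- rewrite (RL_cover phi); congr fsup; rewrite eqEsubset; split.
    by move=> _ [r [s ->]]; exists (- s), (- r); rewrite !opprK.
  by move=> _ [r [s ->]]; exists (- s), (- r).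
Qed.

Definition RL_opp phi : RL L := LR_extend (RL_opp_relations phi).

Lemma RL_oppE phi p q : RL_opp phi (LR_gen p q) = phi (LR_gen (- q) (- p)).
Proof. exact: LR_extend_gen. Qed.

Let RL_add := RL_op liftable_add.
Let RL_mul := RL_op liftable_mul.

Let le3 (w1 w2 w3 : L) : w1 <= w2 -> w2 <= w3 -> w1 <= w3.
Proof. exact: le_trans. Qed.

Let RL_addC : commutative RL_add.
Proof.
move=> f g; apply: RL_eqP => w p q r s w1 w2 no.
apply: (RL_op_elim w1) => {w1} w1 a b c e le1 fa ga B1.
apply: (RL_op_elim (le_trans le1 w2)) => w3 a' b' c' e' le2 ga' fa' B2.
apply: (RL_pt2 (le_trans le2 fa) fa') => x x1 x2 x3 x4.
apply: (RL_pt2 (le_trans le2 ga) ga') => y y1 y2 y3 y4.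
have [] := B1 x y; rewrite // => h1 h2; have [] := B2 y x; rewrite // => h3 h4.
by have [] := no (x + y)%R; rewrite // addrC.
Qed.

Let RL_mulC : commutative RL_mul.
Proof.
move=> f g; apply: RL_eqP => w p q r s w1 w2 no.
apply: (RL_op_elim w1) => {w1} w1 a b c e le1 fa ga B1.
apply: (RL_op_elim (le_trans le1 w2)) => w3 a' b' c' e' le2 ga' fa' B2.
apply: (RL_pt2 (le_trans le2 fa) fa') => x x1 x2 x3 x4.
apply: (RL_pt2 (le_trans le2 ga) ga') => y y1 y2 y3 y4.
have [] := B1 x y; rewrite // => h1 h2; have [] := B2 y x; rewrite // => h3 h4.
by have [] := no (x * y)%R; rewrite // mulrC.
Qed.

Let RL_op_assoc o (Ho : liftable o) : associative o -> associative (RL_op Ho).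
Proof.
move=> oA f g k; apply: RL_eqP => w p q r s w1 w2 no.
apply: (RL_op_elim w1) => {w1} v1 a1 b1 c1 d1 l1 fv1 gkv1 B1.
apply: (RL_op_elim gkv1) => v2 a2 b2 c2 d2 l2 gv2 kv2 B2.
apply: (RL_op_elim (le_trans l2 (le_trans l1 w2))).
move=> v3 a3 b3 c3 d3 l3 fgv3 kv3 B3.
apply: (RL_op_elim fgv3) => v4 a4 b4 c4 d4 l4 fv4 gv4 B4.
have l42 := le_trans l4 l3; have l41 := le_trans l42 l2.
apply: (RL_pt2 (le_trans l41 fv1) fv4) => x x1 x2 x3 x4.
apply: (RL_pt2 (le_trans l42 gv2) gv4) => y y1 y2 y3 y4.
apply: (RL_pt2 (le_trans l42 kv2) (le_trans l4 kv3)) => z z1 z2 z3 z4.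
have [h1 h2] := B2 y z y1 y2 z1 z2; have [h3 h4] := B1 x (o y z) x1 x2 h1 h2.
have [h5 h6] := B4 x y x3 x4 y3 y4; have [h7 h8] := B3 (o x y) z h5 h6 z3 z4.
by have [] := no (o x (o y z)); rewrite // oA.
Qed.

Let RL_op_unit o (Ho : liftable o) c : left_id c o ->
  left_id (RL_const c) (RL_op Ho).
Proof.
move=> oc f; apply: RL_eqP => w p q r s w1 w2 no.
apply: (RL_op_elim w1) => {w1} v1 a1 b1 c1 d1 l1 cv fv B1.
apply: (RL_const_elim cv) => ac cb.
apply: (RL_pt2 fv (le_trans l1 w2)) => x x1 x2 x3 x4.
by have [] := B1 c x; rewrite // oc => h1 h2; have [] := no x.
Qed.

Let RL_addN : left_inverse (RL_const 0) RL_opp RL_add.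
Proof.
move=> f; apply: RL_eqP => w p q r s w1 w2 no.
apply: (RL_const_elim w2) => r0 s0.
apply: (RL_op_elim w1) => {w1} v1 a1 b1 c1 d1 l1 fv1 fv2 B1.
rewrite RL_oppE in fv1; apply: (RL_pt2 fv1 fv2) => x x1 x2 x3 x4.
have [h1 h2] : p < - x + x /\ - x + x < q by apply: B1 => //; lra.
by rewrite addNr in h1 h2; case: (no 0).
Qed.

Let RL_mulDl : left_distributive RL_mul RL_add.
Proof.
move=> f g k; apply: RL_eqP => w p q r s w1 w2 no.
apply: (RL_op_elim w1) => {w1} v1 a1 b1 c1 d1 l1 fgv1 kv1 B1.
apply: (RL_op_elim fgv1) => v2 a2 b2 c2 d2 l2 fv2 gv2 B2.
apply: (RL_op_elim (le_trans l2 (le_trans l1 w2))).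
move=> v3 a3 b3 c3 d3 l3 fkv3 gkv3 B3.
apply: (RL_op_elim fkv3) => v4 a4 b4 c4 d4 l4 fv4 kv4 B4.
apply: (RL_op_elim (le_trans l4 gkv3)) => v5 a5 b5 c5 d5 l5 gv5 kv5 B5.
have l53 := le_trans l5 l4; have l52 := le_trans l53 l3.
have l51 := le_trans l52 l2.
apply: (RL_pt2 (le_trans l52 fv2) (le_trans l5 fv4)) => x x1 x2 x3 x4.
apply: (RL_pt2 (le_trans l52 gv2) gv5) => y y1 y2 y3 y4.
apply: (RL_pt3 (le_trans l51 kv1) (le_trans l5 kv4) kv5) => z z1 z2 z3 z4 z5 z6.
have [h1 h2] := B2 x y x1 x2 y1 y2.
have [h3 h4] := B1 (x + y)%R z h1 h2 z1 z2.
have [h5 h6] := B4 x z x3 x4 z3 z4; have [h7 h8] := B5 y z y3 y4 z5 z6.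
have [h9 h10] := B3 (x * z)%R (y * z)%R h5 h6 h7 h8.
by have [] := no ((x + y) * z)%R; rewrite // mulrDl.
Qed.

HB.instance Definition _ := GRing.isZmodule.Build (RL L)
  (RL_op_assoc liftable_add (@addrA rat)) RL_addC
  (RL_op_unit liftable_add (@add0r rat)) RL_addN.

HB.instance Definition _ := GRing.Zmodule_isComPzRing.Build (RL L)
  (RL_op_assoc liftable_mul (@mulrA rat)) RL_mulC
  (RL_op_unit liftable_mul (@mul1r rat)) RL_mulDl.

Lemma RL_addE phi psi (p q : rat) :
  (phi + psi)%R (LR_gen p q) = RL_op_gen +%R phi psi p q.
Proof. exact: RL_opE. Qed.

Lemma RL_mulE phi psi (p q : rat) :
  (phi * psi)%R (LR_gen p q) = RL_op_gen *%R phi psi p q.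
Proof. exact: RL_opE. Qed.

End RingOfFunctions.

Section Downset.
Context {d : Order.disp_t} {L : frameType d}.
Variable a : L.

Record downset : Type := Downset { down_val : L; down_valP : down_val <= a }.

HB.instance Definition _ := [isSub for down_val].
HB.instance Definition _ := [Choice of downset by <:].
HB.instance Definition _ := [SubChoice_isSubPOrder of downset by <: with d].
Implicit Types (x y : downset) (S : set downset).

Definition down_top : downset := Downset (lexx a).

Lemma down_meet_subproof x y : val x `&` val y <= a.
Proof. exact: le_trans (leIl _ _) (down_valP x). Qed.

Definition down_meet x y : downset := Downset (down_meet_subproof x y).

Lemma down_sup_subproof S : fsup [set val x | x in S] <= a.
Proof. by apply: fsup_le => _ [x _ <-]; exact: down_valP. Qed.

Definition down_sup S : downset := Downset (down_sup_subproof S).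

Lemma down_leE x y : (x <= y) = (val x <= val y).
Proof. by []. Qed.

Lemma down_le_top x : x <= down_top.
Proof. by rewrite down_leE SubK; exact: down_valP. Qed.

Lemma down_le_meet x y z : (x <= down_meet y z) = (x <= y) && (x <= z).
Proof. by rewrite !down_leE lexI. Qed.

Lemma down_sup_ub S x : S x -> x <= down_sup S.
Proof. by move=> Sx; rewrite down_leE SubK; apply: fsup_ub; exists x. Qed.

Lemma down_sup_le S y : (forall x, S x -> x <= y) -> down_sup S <= y.
Proof.
move=> Sy; rewrite down_leE SubK; apply: fsup_le => _ [x Sx <-].
exact: Sy.
Qed.

Lemma down_meet_sup_le x S :
  down_meet x (down_sup S) <= down_sup [set down_meet x s | s in S].
Proof.
rewrite down_leE !SubK; apply: fsup_meet_le => _ [s Ss <-].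
apply: fsup_ub; exists (down_meet x s); last by rewrite SubK.
by exists s.
Qed.

HB.instance Definition _ := POrder_isFrame.Build d downset
  down_le_top down_le_meet down_sup_ub down_sup_le down_meet_sup_le.

Lemma down_proj_subproof (x : L) : a `&` x <= a.
Proof. exact: leIl. Qed.

Definition down_proj (x : L) : downset := Downset (down_proj_subproof x).

Lemma down_proj1 : down_proj \top = \top.
Proof. by apply: val_inj; exact: meetx1. Qed.

Lemma down_projI : {morph down_proj : x y / x `&` y}.
Proof.
move=> x y; apply: val_inj => /=.
by rewrite -[LHS](congr1 (fun z => z `&` (x `&` y)) (meetxx a)) meetACA.
Qed.

Lemma down_proj_sup (S : set L) : down_proj (fsup S) = fsup (down_proj @` S).
Proof.
apply: val_inj => /=; rewrite meet_fsup; congr fsup.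
rewrite eqEsubset; split.
  by move=> _ [x Sx <-]; exists (down_proj x) => //; exists x.
by move=> _ [_ [x Sx <-] <-]; exists x.
Qed.

HB.instance Definition _ := isFrameMorphism.Build _ _ _ _ down_proj
  down_proj1 down_projI down_proj_sup.

End Downset.

Definition Cstar_quotient d (L : frameType d) d' (M : frameType d')
    (pi : {fmorphism L -> M}) : Prop :=
  (forall y, exists x, pi x = y) /\
  forall g : RL M, bounded g -> exists g' : RL L, forall u, g u = pi (g' u).

Section Classes.
Context {d : Order.disp_t}.
Variable L : frameType d.

Definition Coz : set L := [set coz phi | phi in [set: RL L]].

Definition PF_frame : Prop :=
  forall a b : L, Coz a -> Coz b -> a `&` b = \bot ->
    complemented a \/ complemented b.

(** The P-frame condition relaxed to comaximal pairs; spatially: at most one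
    point fails to be a P-point. Counting the non-complemented cozero elements
    of [L] would be too strong: a completely regular frame with at most one of
    them has none. Indeed, if [a] is one, take [c] in [Coz], nonzero and
    completely below [a]; then [c] is complemented and [a `&` pcompl c] is a
    second one. *)
Definition essential_P_frame : Prop :=
  forall a b : L, Coz a -> Coz b -> a `|` b = \top ->
    complemented a \/ complemented b.

Definition F_frame : Prop :=
  forall a : L, Coz a -> Cstar_quotient (down_proj a : {fmorphism L -> downset a}).

End Classes.

Section Ideals.
Variable R : comPzRingType.
Implicit Types I J P Q : set R.

(** Ideals of [R]; the improper ideal is allowed. *)
Definition is_ideal I : Prop :=
  [/\ I 0, forall x y, I x -> I y -> I (x + y) & forall r x, I x -> I (r * x)].

Definition principal_ideal (x : R) : set R := [set r * x | r in [set: R]].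

Definition ideal_mul I J : set R :=
  [set z | exists s : seq (R * R),
     (forall p, p \in s -> I p.1 /\ J p.2) /\ z = \sum_(p <- s) p.1 * p.2].

Fixpoint ideal_pow I (n : nat) : set R :=
  match n with
  | 0 => setT
  | 1 => I
  | n'.+1 => ideal_mul (ideal_pow I n') I
  end.

Definition is_proper_ideal I : Prop := is_ideal I /\ I <> setT.

Definition semiprime I : Prop :=
  is_proper_ideal I /\
  forall J n, is_ideal J -> (0 < n)%N -> ideal_pow J n `<=` I -> J `<=` I.

(** [rng_ideal I J]: [J] is an ideal of the ring without identity [I]. *)
Definition rng_ideal I J : Prop :=
  [/\ J `<=` I, J 0, forall x y, J x -> J y -> J (x - y) &
      forall r x, I r -> J x -> J (r * x)].

Definition rng_prime I P : Prop :=
  [/\ rng_ideal I P, P <> I &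
      forall x y, I x -> I y -> P (x * y) -> P x \/ P y].

Definition rng_maximal I P : Prop :=
  [/\ rng_ideal I P, P <> I &
      forall Q, rng_ideal I Q -> P `<=` Q -> Q = P \/ Q = I].

Definition P_ideal I : Prop :=
  is_ideal I /\
  (I = [set 0] \/ forall P, rng_prime I P -> rng_maximal I P).

End Ideals.

(* Main.v *)
(** The ring [RL L] is reduced and has cube roots, and [f] is von Neumann regular
    exactly when [coz f] is complemented. In a reduced ring an ideal is a
    [P]-ideal iff all its elements are regular (a prime avoiding all
    [f ^+ n * (1 - f * h)] traces a non-maximal prime otherwise), and with cube
    roots a principal ideal is semiprime only if its generator is regular. Since
    [coz (f * g)] is [coz f `&` coz g], conditions (3)-(5) all say that of two
    elements whose product is zero, or regular, one is regular.

    For (6), let [phi] be a bounded function on a non-complemented [a] in [Coz L],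
    in a [PF]-frame. For [s < t] the cozero elements [{phi < s}] and [{phi > t}] are
    disjoint, so one of them is complemented; [V t := {phi > t}] if this is
    complemented and [V t := pcompl {phi < t}] otherwise are then the upper level
    sets of an extension of [phi]. *)
Require Import Defs.
From mathcomp Require Import all_boot all_order all_algebra.
From mathcomp Require Import boolp classical_sets.
From mathcomp Require Import ring lra.

Set Implicit Arguments.
Unset Strict Implicit.

Import Order.TTheory GRing.Theory Num.Theory.

Local Open Scope ring_scope.
Local Open Scope classical_set_scope.
Local Open Scope order_scope.

(** * Functions from scales *)

Section FrameLemmas.
Context {d : Order.disp_t} {L : frameType d}.
Implicit Types a b c x y z w : L.

Lemma meet_pcompl a : a `&` pcompl a = \bot.
Proof.
apply: le_anti; rewrite le0x andbT; apply: fsup_meet_le => x xa.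
by rewrite meetC xa.
Qed.

Lemma le_pcompl a x : x `&` a = \bot -> x <= pcompl a.
Proof. by move=> xa; apply: fsup_ub. Qed.

Lemma pcompl_le a b : a <= b -> pcompl b <= pcompl a.
Proof.
move=> ab; apply: le_pcompl; apply: le_anti; rewrite le0x andbT.
by apply: le_trans (leI2 (lexx _) ab) _; rewrite meetC meet_pcompl.
Qed.

Lemma complementedP a :
  complemented a <-> exists c, a `&` c = \bot /\ a `|` c = \top.
Proof.
split=> [ca|[c [ac0 ac1]]].
  by exists (pcompl a); rewrite meet_pcompl.
apply: le_anti; rewrite lex1 -ac1 leU2 //=.
by apply: le_pcompl; rewrite meetC.
Qed.

Lemma complemented0 : complemented (\bot : L).
Proof. by apply/complementedP; exists \top; rewrite meet0x join0x. Qed.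

Lemma complementedU a b :
  complemented a -> complemented b -> complemented (a `|` b).
Proof.
move=> ca cb; apply/complementedP; exists (pcompl a `&` pcompl b); split.
  by rewrite meetUl meetA meet_pcompl meet0x join0x meetCA meet_pcompl meetx0.
by rewrite joinIr joinAC ca join1x -joinA cb joinx1 meetxx.
Qed.

Lemma complemented_pcompl a : complemented a -> complemented (pcompl a).
Proof.
move=> ca; apply/complementedP; exists a.
by rewrite meetC meet_pcompl joinC.
Qed.

(** The complement of [a] is the join of [b] with the pseudocomplement of the whole. *)
Lemma complemented_disjointU a b :
  a `&` b = \bot -> complemented (a `|` b) -> complemented a.
Proof.
move=> ab0 cab; apply/complementedP; exists (b `|` pcompl (a `|` b)); split.
  rewrite meetUr ab0 join0x; apply: le_anti; rewrite le0x andbT.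
  by rewrite -(meet_pcompl (a `|` b)) leI2 ?leUl.
by rewrite joinA.
Qed.

Lemma complemented_rather_below a : complemented a -> rather_below a a.
Proof. by move=> ca; exists (pcompl a); rewrite meet_pcompl joinC. Qed.

Lemma rather_below_le a b : rather_below a b -> a <= b.
Proof.
move=> [t [at0 tb1]].
by rewrite -[a]meetx1 -tb1 meetUr at0 join0x leIr.
Qed.

Lemma rather_belowS a a' b b' :
  a' <= a -> b <= b' -> rather_below a b -> rather_below a' b'.
Proof.
move=> aa bb [t [at0 tb1]]; exists t; split; apply: le_anti.
  by rewrite le0x andbT -at0 leI2.
by rewrite lex1 -tb1 leU2.
Qed.

Lemma rather_belowI a a' b b' : rather_below a b -> rather_below a' b' ->
  rather_below (a `&` a') (b `&` b').
Proof.
move=> [t [at0 tb1]] [s [as0 sb1]]; exists (t `|` s); split.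
  by rewrite meetUr meetAC at0 meet0x -meetA as0 meetx0 joinxx.
by rewrite joinIr joinAC tb1 join1x -joinA sb1 joinx1 meetxx.
Qed.

Lemma rather_belowU a a' b b' : rather_below a b -> rather_below a' b' ->
  rather_below (a `|` a') (b `|` b').
Proof.
move=> [t [at0 tb1]] [s [as0 sb1]]; exists (t `&` s); split.
  by rewrite meetUl meetA at0 meet0x join0x meetCA as0 meetx0.
by rewrite joinIl joinA tb1 join1x meet1x [X in _ `|` X]joinC joinA sb1 join1x.
Qed.

Lemma rather_below_pcompl a b : rather_below a b -> pcompl a `|` b = \top.
Proof.
move=> [t [at0 tb1]]; apply: le_anti; rewrite lex1 -tb1 leU2 //=.
by apply: le_pcompl; rewrite meetC.
Qed.

End FrameLemmas.

(** * Upper and lower rays of a function *)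

Section Rays.
Context {d : Order.disp_t} {L : frameType d}.
Implicit Types (phi psi : RL L) (w v : L) (p q r s t : rat).

Lemma RL_gen_le phi p q r s : p <= r -> s <= q ->
  phi (LR_gen r s) <= phi (LR_gen p q).
Proof. exact: LR_relations_le (LR_relations_hom phi) _ _ _ _. Qed.

(** An interval without rational points has value bottom, so a bound on [w] may be proved with a
    rational of the interval in hand. *)
Lemma RL_elim phi w v p q : w <= phi (LR_gen p q) ->
  (forall x : rat, p < x -> x < q -> w <= v) -> w <= v.
Proof.
move=> wpq h; case: (ltP p q) => [pq|qp].
  by apply: (h ((p + q) / 2%:R)); lra.
apply: le_trans wpq _; rewrite RL_sup.
apply: fsup_le => x [r [s [pr rs sq _]]]; exfalso; lra.
Qed.

Lemma RL_cap phi w p q r s :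
  w <= phi (LR_gen p q) -> w <= phi (LR_gen r s) ->
  w <= phi (LR_gen (Order.max p r) (Order.min q s)).
Proof. by move=> w1 w2; rewrite -RL_meet lexI w1. Qed.

(** [RL_up phi p] is [phi(p, -)] and [RL_dn phi q] is [phi(-, q)]. *)
Definition RL_up phi p : L := fsup [set x | exists q, x = phi (LR_gen p q)].
Definition RL_dn phi q : L := fsup [set x | exists p, x = phi (LR_gen p q)].

Lemma RL_le_up phi p q : phi (LR_gen p q) <= RL_up phi p.
Proof. by apply: fsup_ub; exists q. Qed.

Lemma RL_le_dn phi p q : phi (LR_gen p q) <= RL_dn phi q.
Proof. by apply: fsup_ub; exists p. Qed.

Lemma RL_up_le phi p q : p <= q -> RL_up phi q <= RL_up phi p.
Proof.
move=> pq; apply: fsup_le => _ [r ->]; apply: le_trans (RL_le_up _ _ r).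
exact: RL_gen_le.
Qed.

Lemma RL_dn_le phi p q : p <= q -> RL_dn phi p <= RL_dn phi q.
Proof.
move=> pq; apply: fsup_le => _ [r ->]; apply: le_trans (RL_le_dn _ r _).
exact: RL_gen_le.
Qed.

Lemma RL_genE phi p q : phi (LR_gen p q) = RL_up phi p `&` RL_dn phi q.
Proof.
apply: le_anti; rewrite lexI RL_le_up RL_le_dn /=.
apply: fsup_meet2_le => _ _ [b ->] [a ->]; rewrite RL_meet.
by apply: RL_gen_le; rewrite ?le_max ?ge_min ?lexx ?orbT.
Qed.

Lemma RL_up_dn0 phi p q : q <= p -> RL_up phi p `&` RL_dn phi q = \bot.
Proof.
move=> qp; apply: le_anti; rewrite le0x andbT -RL_genE.
apply: (RL_elim (lexx _)) => x *; exfalso; lra.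
Qed.

Lemma RL_up_dn1 phi p q : p < q -> RL_up phi p `|` RL_dn phi q = \top.
Proof.
move=> pq; apply: le_anti; rewrite lex1 /= (RL_cover phi).
apply: fsup_le => _ [a [b ->]].
(* Once enlarged to contain [(p, q)], the interval is covered by its parts below [q] and above
   [p]. *)
apply: (@le_trans _ _ (phi (LR_gen (Order.min a p) (Order.max b q)))).
  by apply: RL_gen_le; rewrite ?le_max ?ge_min ?lexx ?orbT.
rewrite -(@RL_join _ _ _ _ q p) //; last 2 first.
- by rewrite ge_min lexx orbT.
- by rewrite le_max lexx orbT.
by rewrite joinC leU2 ?RL_le_up ?RL_le_dn.
Qed.

Lemma RL_upE phi p :
  RL_up phi p = fsup [set x | exists2 r : rat, p < r & x = RL_up phi r].
Proof.
apply: le_anti; apply/andP; split; last first.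
  by apply: fsup_le => _ [r pr ->]; apply: RL_up_le; exact: ltW.
apply: fsup_le => _ [q ->]; rewrite RL_sup.
apply: fsup_le => _ [r [s [pr _ _ ->]]]; apply: le_trans (RL_le_up _ _ _) _.
by apply: fsup_ub; exists r.
Qed.

Lemma RL_dnE phi q :
  RL_dn phi q = fsup [set x | exists2 r : rat, r < q & x = RL_dn phi r].
Proof.
apply: le_anti; apply/andP; split; last first.
  by apply: fsup_le => _ [r pr ->]; apply: RL_dn_le; exact: ltW.
apply: fsup_le => _ [p ->]; rewrite RL_sup.
apply: fsup_le => _ [r [s [_ _ sq ->]]]; apply: le_trans (RL_le_dn _ _ _) _.
by apply: fsup_ub; exists s.
Qed.

Lemma RL_up_cover phi : fsup [set x | exists p, x = RL_up phi p] = \top.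
Proof.
apply: le_anti; rewrite lex1 (RL_cover phi) /=; apply: fsup_le => _ [p [q ->]].
by apply: le_trans (RL_le_up _ _ _) _; apply: fsup_ub; exists p.
Qed.

Lemma RL_dn_cover phi : fsup [set x | exists p, x = RL_dn phi p] = \top.
Proof.
apply: le_anti; rewrite lex1 (RL_cover phi) /=; apply: fsup_le => _ [p [q ->]].
by apply: le_trans (RL_le_dn _ _ _) _; apply: fsup_ub; exists q.
Qed.

Lemma pcompl_up_le phi p q : p < q -> pcompl (RL_up phi p) <= RL_dn phi q.
Proof.
move=> pq; rewrite -[leLHS]meetx1 -(RL_up_dn1 phi pq) meetUr.
by rewrite [_ `&` RL_up _ _]meetC meet_pcompl join0x leIr.
Qed.

Lemma up_le_pcompl phi p q : q <= p -> RL_up phi p <= pcompl (RL_dn phi q).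
Proof. by move=> qp; apply: le_pcompl; exact: RL_up_dn0. Qed.

Lemma dn_le_pcompl phi p q : q <= p -> RL_dn phi q <= pcompl (RL_up phi p).
Proof. by move=> qp; apply: le_pcompl; rewrite meetC; exact: RL_up_dn0. Qed.

Lemma RL_up_rather_below phi p q : q < p -> rather_below (RL_up phi p) (RL_up phi q).
Proof.
move=> qp; exists (RL_dn phi p); rewrite RL_up_dn0 //; split=> //.
by rewrite joinC RL_up_dn1.
Qed.

Lemma RL_dn_rather_below phi p q : p < q -> rather_below (RL_dn phi p) (RL_dn phi q).
Proof.
by move=> qp; exists (RL_up phi p); rewrite meetC RL_up_dn0 // RL_up_dn1.
Qed.

(** The pointfree form of: functions that agree at every point are equal. *)
Lemma RL_eqP phi psi :
  (forall w p q r s, w <= phi (LR_gen p q) -> w <= psi (LR_gen r s) ->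
    (forall x : rat, p < x -> x < q -> r < x -> x < s -> False) -> w <= \bot) ->
  phi = psi.
Proof.
have key (f g : RL L) :
    (forall w p q r s, w <= f (LR_gen p q) -> w <= g (LR_gen r s) ->
    (forall x : rat, p < x -> x < q -> r < x -> x < s -> False) -> w <= \bot) ->
    forall p q, f (LR_gen p q) <= g (LR_gen p q).
  move=> h p q; rewrite [in leLHS]RL_sup.
  apply: fsup_le => _ [r [s [pr rs sq ->]]]; rewrite (RL_genE g) lexI.
  apply/andP; split.
    (* The lower ray of [g] at [r] contributes only bottom, having no rational in common with
       [(r, s)]. *)
    rewrite -[leLHS]meetx1 -(RL_up_dn1 g pr) meetUr leUx leIr /=.
    apply: fsup_meet_le => _ [y ->]; apply: le_trans (le0x _).
    by apply: h (leIl _ _) (leIr _ _) _ => x *; lra.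
  rewrite -[leLHS]meetx1 -(RL_up_dn1 g sq) meetUr leUx leIr /= andbT.
  apply: fsup_meet_le => _ [y ->]; apply: le_trans (le0x _).
  by apply: h (leIl _ _) (leIr _ _) _ => x *; lra.
move=> h; apply: LR_hom_ext => p q; apply: le_anti; apply/andP; split.
  exact: key.
apply: key => w a b r s h1 h2 h3; apply: (h w _ _ _ _ h2 h1) => x ? ? ? ?.
exact: (h3 x).
Qed.

End Rays.

(** * Functions from decreasing scales *)

Section Scale.
Context {d : Order.disp_t} {L : frameType d}.
Variable V : rat -> L.
Hypothesis V_below : forall s t : rat, s < t -> rather_below (V t) (V s).
Hypothesis V_top : fsup [set x | exists t, x = V t] = \top.
Hypothesis V_bot : fsup [set x | exists t, x = pcompl (V t)] = \top.

Let V_le s t : s <= t -> V t <= V s.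
Proof.
by rewrite le_eqVlt => /predU1P[->//|/V_below/rather_below_le].
Qed.

(** [V] need not be continuous in its index; joining over strictly larger, or strictly smaller,
    indices gives rays for which [LR_sup] holds. *)
Let U p : L := fsup [set x | exists2 t : rat, p < t & x = V t].
Let D q : L := fsup [set x | exists2 t : rat, t < q & x = pcompl (V t)].

Let U_ub p t : p < t -> V t <= U p.
Proof. by move=> pt; apply: fsup_ub; exists t. Qed.

Let D_ub q t : t < q -> pcompl (V t) <= D q.
Proof. by move=> pt; apply: fsup_ub; exists t. Qed.

Let U_mono p q : p <= q -> U q <= U p.
Proof. by move=> pq; apply: fsup_le => _ [t qt ->]; apply: U_ub; lra. Qed.

Let D_mono p q : p <= q -> D p <= D q.
Proof. by move=> pq; apply: fsup_le => _ [t qt ->]; apply: D_ub; lra. Qed.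

Let UD0 p q : q <= p -> U p `&` D q = \bot.
Proof.
move=> qp; apply: le_anti; rewrite le0x andbT.
apply: fsup_meet2_le => _ _ [t pt ->] [s sq ->].
by rewrite -(meet_pcompl (V s)) leI2 // V_le //; lra.
Qed.

Let UD1 p q : p < q -> D q `|` U p = \top.
Proof.
(* Since [p < s < t < q], one strict step of the scale, from [t] to [s], fits between the two
   rays. *)
move=> pq; pose s := (p + (p + q) / 2%:R) / 2%:R; pose t := (q + (p + q) / 2%:R) / 2%:R.
apply: le_anti; rewrite lex1 /=.
have st : s < t by rewrite /s /t; lra.
rewrite -(rather_below_pcompl (V_below st)) leU2 ?D_ub ?U_ub // /s /t; lra.
Qed.

Let scale_relations : LR_relations (fun p q => U p `&` D q).
Proof.
have U_max p r : U p `&` U r = U (Order.max p r).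
  case: (leP p r) => [pr|/ltW rp]; first by apply/meet_idPr; exact: U_mono.
  by apply/meet_idPl; exact: U_mono.
have D_min p r : D p `&` D r = D (Order.min p r).
  case: (leP p r) => [pr|/ltW rp]; first by apply/meet_idPl; exact: D_mono.
  by apply/meet_idPr; exact: D_mono.
split.
- by move=> p q r s; rewrite meetACA U_max D_min.
- move=> p q r s pr rq qs; apply: le_anti; apply/andP; split.
    by rewrite leUx !leI2 ?U_mono ?D_mono.
  rewrite -[leLHS]meetx1 -(UD1 rq) meetUr leU2 //.
    by rewrite lexI leIr andbT; apply: le_trans (leIl _ _) (leIl _ _).
  by rewrite lexI leIr /=; apply: le_trans (leIl _ _) (leIr _ _).
- move=> p q; apply: le_anti; apply/andP; split; last first.
    by apply: fsup_le => _ [r [s [pr rs sq ->]]]; rewrite leI2 ?U_mono ?D_mono ?ltW.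
  apply: fsup_meet2_le => _ _ [t pt ->] [s sq ->].
  pose r := (p + t) / 2%:R; pose u := (s + q) / 2%:R.
  have Vr : V t <= U r by apply: U_ub; rewrite /r; lra.
  have Du : pcompl (V s) <= D u by apply: D_ub; rewrite /u; lra.
  apply: le_trans (leI2 Vr Du) _; case: (ltP r u) => [ru|/UD0 ->//].
  by apply: fsup_ub; exists r, u; split=> //; rewrite /r /u; lra.
- apply: le_anti; rewrite lex1 andbT -[leLHS]meetxx -[X in X `&` _]V_top -V_bot.
  apply: fsup_meet2_le => _ _ [t ->] [s ->].
  apply: (@le_trans _ _ (U (t - 1) `&` D (s + 1))).
    by rewrite leI2 ?U_ub ?D_ub //; lra.
  by apply: fsup_ub; exists (t - 1)%R, (s + 1)%R.
Qed.

Lemma RL_scale : exists phi : RL L,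
  (forall p, RL_up phi p = fsup [set x | exists2 t : rat, p < t & x = V t]) /\
  (forall q, RL_dn phi q = fsup [set x | exists2 t : rat, t < q & x = pcompl (V t)]).
Proof.
have E p q : LR_extend scale_relations (LR_gen p q) = U p `&` D q.
  exact: LR_extend_gen.
exists (LR_extend scale_relations); split=> [p|q]; apply: le_anti; apply/andP; split.
- by apply: fsup_le => _ [q ->]; rewrite E leIl.
(* The cover [V_bot] cuts the upper ray into pieces bounded above, each inside an interval. *)
- rewrite -[leLHS]meetx1 -[X in _ `&` X]V_bot.
  apply: fsup_meet_le => _ [t ->]; apply: le_trans (RL_le_up _ _ (t + 1)).
  by rewrite E leI2 ?D_ub // ltrDl.
- by apply: fsup_le => _ [p ->]; rewrite E leIr.
- rewrite -[leLHS]meet1x -[X in X `&` _]V_top meetC.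
  apply: fsup_meet_le => _ [t ->]; apply: le_trans (RL_le_dn _ (t - 1) _).
  by rewrite E meetC leI2 ?U_ub // ltrBlDr ltrDl.
Qed.

End Scale.

(** * Cozero elements *)

Section Cozero.
Context {d : Order.disp_t} {L : frameType d}.
Implicit Types (phi psi f g : RL L) (a b w v : L) (p q r s t : rat).

Lemma cozE phi : coz phi = RL_dn phi 0 `|` RL_up phi 0.
Proof.
apply: le_anti; apply/andP; split.
  by apply: fsup_le => _ [p [q ->]]; rewrite leU2 ?RL_le_dn ?RL_le_up.
rewrite leUx; apply/andP; split; apply: fsup_le => _ [p ->].
  by apply: le_trans (leUl _ (phi (LR_gen 0 0))) _; apply: fsup_ub; exists p, 0.
by apply: le_trans (leUr _ (phi (LR_gen 0 0))) _; apply: fsup_ub; exists 0, p.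
Qed.

(** The value of an interval that misses zero lies below [coz phi]; so outside [coz phi] zero may be
    used as a point of the interval. *)
Lemma coz_cases phi w v p q : w <= phi (LR_gen p q) ->
  (p < 0 -> 0 < q -> w <= v) -> coz phi <= v -> w <= v.
Proof.
move=> wpq h; rewrite cozE leUx => /andP[h1 h2].
case: (ltP p 0) => [p0|p0]; last first.
  apply: le_trans h2; apply: le_trans wpq (le_trans (RL_le_up _ _ _) _).
  exact: RL_up_le.
case: (ltP 0 q) => [q0|q0]; first exact: h.
apply: le_trans h1; apply: le_trans wpq (le_trans (RL_le_dn _ _ _) _).
exact: RL_dn_le.
Qed.

Lemma coz_le phi v : (forall p q, 0 <= p \/ q <= 0 -> phi (LR_gen p q) <= v) ->
  coz phi <= v.
Proof.
move=> h; rewrite cozE leUx; apply/andP; split; apply: fsup_le => _ [p ->].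
  by apply: h; right.
by apply: h; left.
Qed.

Lemma RL_add_elim w v phi psi p q : w <= (phi + psi)%R (LR_gen p q) ->
  (forall w' (r s t u : rat), w' <= w -> w' <= phi (LR_gen r s) ->
     w' <= psi (LR_gen t u) -> in_box +%R r s t u p q -> w' <= v) -> w <= v.
Proof. exact: (@RL_op_elim _ _ _ liftable_add). Qed.

Lemma RL_mul_elim w v phi psi p q : w <= (phi * psi)%R (LR_gen p q) ->
  (forall w' (r s t u : rat), w' <= w -> w' <= phi (LR_gen r s) ->
     w' <= psi (LR_gen t u) -> in_box *%R r s t u p q -> w' <= v) -> w <= v.
Proof. exact: (@RL_op_elim _ _ _ liftable_mul). Qed.

Lemma le_RL_mul phi psi p q r s t u : in_box *%R r s t u p q ->
  phi (LR_gen r s) `&` psi (LR_gen t u) <= (phi * psi)%R (LR_gen p q).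
Proof. by move=> b; rewrite RL_mulE; apply: fsup_ub; exists r, s, t, u. Qed.

Lemma coz0 : coz (0%R : RL L) = \bot.
Proof.
apply: le_anti; rewrite le0x andbT; apply: coz_le => p q pq.
by apply: (RL_const_elim (lexx _)) => p0 q0; exfalso; lra.
Qed.

Lemma coz1 : coz (1%R : RL L) = \top.
Proof.
apply: le_anti; rewrite lex1 cozE /=.
apply: le_trans (leUr _ _); apply: le_trans (RL_le_up _ _ 2%:R).
by rewrite (_ : (1%R : RL L) _ = \top) //; exact: (RL_constE 1 0 2%:R).
Qed.

Lemma coz_eq0 phi : coz phi = \bot -> phi = 0%R.
Proof.
move=> c0; apply: RL_eqP => w p q r s w1 w2 no.
apply: (RL_const_elim w2) => r0 s0.
by apply: (coz_cases w1) => [p0 q0|]; [case: (no 0)|rewrite c0].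
Qed.

Lemma cozD phi psi : coz (phi + psi)%R <= coz phi `|` coz psi.
Proof.
apply: coz_le => p q pq; apply: (RL_add_elim (lexx _)) => w r s t u _ h1 h2 b.
apply: (coz_cases h1) (leUl _ _) => r0 s0; apply: (coz_cases h2) (leUr _ _) => t0 u0.
by have [] := b 0 0 r0 s0 t0 u0; rewrite addr0 => *; exfalso; lra.
Qed.

Let coz_mul_le phi psi : coz (phi * psi)%R <= coz phi.
Proof.
apply: coz_le => p q pq; apply: (RL_mul_elim (lexx _)) => w r s t u _ h1 h2 b.
apply: (coz_cases h1) => // r0 s0; apply: (RL_elim h2) => y ty yu.
by have [] := b 0 y r0 s0 ty yu; rewrite mul0r => *; exfalso; lra.
Qed.

Lemma cozM phi psi : coz (phi * psi)%R = coz phi `&` coz psi.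
Proof.
apply: le_anti; rewrite lexI coz_mul_le mulrC coz_mul_le mulrC /=.
apply: fsup_meet2_le => _ _ [p [q ->]] [r [s ->]].
have le0 (a b : rat) : b <= 0 \/ 0 <= a ->
    (phi * psi)%R (LR_gen a b) <= coz (phi * psi)%R.
  by move=> h; apply: (coz_cases (lexx _)) => // w0 v0; exfalso; lra.
(* One case for each pair of signs: the products lie strictly between zero and the product of the
   outer endpoints. *)
rewrite meetUl !meetUr !leUx; apply/andP; split; apply/andP; split.
- apply: (le_trans (@le_RL_mul _ _ 0 (p * r)%R _ _ _ _ _)); last by apply: le0; auto.
  by move=> x y *; split; nra.
- apply: (le_trans (@le_RL_mul _ _ (p * s)%R 0 _ _ _ _ _)); last by apply: le0; auto.
  by move=> x y *; split; nra.
- apply: (le_trans (@le_RL_mul _ _ (q * r)%R 0 _ _ _ _ _)); last by apply: le0; auto.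
  by move=> x y *; split; nra.
- apply: (le_trans (@le_RL_mul _ _ 0 (q * s)%R _ _ _ _ _)); last by apply: le0; auto.
  by move=> x y *; split; nra.
Qed.

Lemma RL_reduced phi : (phi * phi = 0)%R -> phi = 0%R.
Proof. by move=> h; apply: coz_eq0; rewrite -(meetxx (coz phi)) -cozM h coz0. Qed.

Lemma RL_dn_sqr phi : RL_dn (phi * phi)%R 0 = \bot.
Proof.
apply: le_anti; rewrite le0x andbT; apply: fsup_le => _ [p ->].
apply: (RL_mul_elim (lexx _)) => w r s t u _ h1 h2 b.
(* Both intervals belong to [phi], so one rational serves for both factors, and its square is not
   negative. *)
apply: (RL_elim (RL_cap h1 h2)) => x; rewrite gt_max lt_min.
move=> /andP[r0 t0] /andP[s0 u0].
by have [_] := b x x r0 s0 t0 u0; rewrite -expr2 ltNge sqr_ge0.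
Qed.

Lemma RL_up_sqr phi : RL_up (phi * phi)%R 0 = coz phi.
Proof. by rewrite -[RHS]meetxx -cozM cozE RL_dn_sqr join0x. Qed.

Lemma RL_upD phi psi : RL_up (phi + psi)%R 0 <= RL_up phi 0 `|` RL_up psi 0.
Proof.
apply: fsup_le => _ [q ->].
apply: (RL_add_elim (lexx _)) => w r s t u _ h1 h2 b.
case: (leP 0 r) => r0.
  by apply: le_trans h1 (le_trans (RL_le_up _ _ _) (le_trans (RL_up_le _ r0) (leUl _ _))).
case: (leP 0 t) => t0.
  by apply: le_trans h2 (le_trans (RL_le_up _ _ _) (le_trans (RL_up_le _ t0) (leUr _ _))).
apply: (RL_elim h1) => x rx xs; apply: (RL_elim h2) => y ty yu.
(* As [r] and [t] are negative, both points can be moved to negative ones inside their intervals;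
   the sum is then negative, against the lower bound zero. *)
have /andP[x0 xs'] : (r < Order.min x (r / 2%:R)) && (Order.min x (r / 2%:R) < s).
  by rewrite lt_min gt_min rx xs /=; apply/andP; split=> //; lra.
have /andP[y0 yu'] : (t < Order.min y (t / 2%:R)) && (Order.min y (t / 2%:R) < u).
  by rewrite lt_min gt_min ty yu /=; apply/andP; split=> //; lra.
have [] := b _ _ x0 xs' y0 yu'.
have : Order.min x (r / 2%:R) <= r / 2%:R by rewrite ge_min lexx orbT.
have : Order.min y (t / 2%:R) <= t / 2%:R by rewrite ge_min lexx orbT.
move=> *; exfalso; move: b h1 h2 => _ _ _; lra.
Qed.

Lemma RL_upN phi : RL_up (- phi)%R 0 = RL_dn phi 0.
Proof.
rewrite /RL_up /RL_dn; congr fsup; rewrite eqEsubset; split=> [_ [q ->]|_ [q ->]].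
  by exists (- q); rewrite RL_oppE oppr0.
by exists (- q); rewrite RL_oppE opprK oppr0.
Qed.

(** The model is [V t] as the set where the absolute value of a function exceeds [t]; hence only
    positive indices are constrained. *)
Definition cozero_scale (V : rat -> L) : Prop :=
  forall s t, 0 < s -> s < t -> rather_below (V t) (V s).

Lemma Coz_scale V :
  cozero_scale V -> Coz (fsup [set x | exists2 t : rat, 0 < t & x = V t]).
Proof.
(* Top up to zero makes the function nonnegative, and bottom beyond one makes it bounded, which
   yields the two covers. *)
move=> sV; pose W t : L := if t <= 0 then \top else if t <= 1 then V t else \bot.
have rbT x : rather_below x (\top : L) by exists \bot; rewrite meetx0 joinx1.
have rbB x : rather_below (\bot : L) x by exists \top; rewrite meet0x join1x.
have [||| phi [U D]] := @RL_scale _ _ W.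
- move=> s t st; rewrite /W; case: (leP s 0) => [_|s0]; first exact: rbT.
  case: (leP t 0) => [t0|_]; first by exfalso; lra.
  case: (leP t 1) => [t1|_]; last exact: rbB.
  by rewrite ifT; [exact: sV|lra].
- by apply: le_anti; rewrite lex1; apply: fsup_ub; exists 0; rewrite /W lexx.
- apply: le_anti; rewrite lex1; apply: fsup_ub; exists 2%:R.
  apply: le_anti; rewrite lex1 andbT; apply: le_pcompl.
  by rewrite [W _](_ : _ = \bot) ?meetx0.
exists phi => //; rewrite cozE U D.
have -> : fsup [set x | exists2 t : rat, t < 0 & x = pcompl (W t)] = \bot.
  apply: le_anti; rewrite le0x andbT; apply: fsup_le => _ [t t0 ->].
  by rewrite -[leLHS]meet1x /W ifT ?meet_pcompl // ltW.
rewrite join0x; apply: le_anti; apply/andP; split; apply: fsup_le => _ [t t0 ->].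
  rewrite /W leNgt t0 /=; case: (leP t 1) => // _; by apply: fsup_ub; exists t.
(* Truncation at one loses nothing, since [V] grows as its index decreases; halving keeps the new
   index strictly below [t]. *)
apply: (@le_trans _ _ (W (Order.min (t / 2%:R) 1))); last first.
  by apply: fsup_ub; exists (Order.min (t / 2%:R) 1) => //; rewrite lt_min; lra.
have m0 : 0 < Order.min (t / 2%:R) 1 by rewrite lt_min; lra.
rewrite /W leNgt m0 ge_min lexx orbT /=; apply: rather_below_le; apply: sV => //.
by rewrite gt_min; apply/orP; left; lra.
Qed.

(** With this description, joins of cozero elements and cozero elements of a down-set are handled on
    scales, without constructing functions. *)
Lemma CozP a : Coz a <->
  exists2 V, cozero_scale V & a = fsup [set x | exists2 t : rat, 0 < t & x = V t].
Proof.
split=> [[phi _ <-]|[V sV ->]]; last exact: Coz_scale.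
exists (fun t => RL_dn phi (- t) `|` RL_up phi t).
  move=> s t s0 st; apply: rather_belowU; last exact: RL_up_rather_below.
  by apply: RL_dn_rather_below; lra.
rewrite cozE; apply: le_anti; rewrite leUx; apply/andP; split; last first.
  apply: fsup_le => _ [t t0 ->]; rewrite leU2 ?RL_up_le ?RL_dn_le //; lra.
rewrite RL_dnE RL_upE; apply/andP; split; apply: fsup_le => _ [t t0 ->].
  apply: le_trans (leUl _ (RL_up phi (- t))) _; apply: fsup_ub; exists (- t); first lra.
  by rewrite opprK.
by apply: le_trans (leUr _ (RL_dn phi (- t))) _; apply: fsup_ub; exists t.
Qed.

Lemma cozero_scale_le V s t : cozero_scale V -> 0 < s -> s <= t -> V t <= V s.
Proof.
move=> sV s0; rewrite le_eqVlt => /predU1P[->//|st].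
by apply: rather_below_le; exact: sV.
Qed.

Lemma Coz_coz phi : Coz (coz phi).
Proof. by exists phi. Qed.

Lemma CozI a b : Coz a -> Coz b -> Coz (a `&` b).
Proof. by move=> [f _ <-] [g _ <-]; rewrite -cozM; exact: Coz_coz. Qed.

Lemma CozU a b : Coz a -> Coz b -> Coz (a `|` b).
Proof.
move=> /CozP[V sV ->] /CozP[W sW ->]; apply/CozP.
exists (fun t => V t `|` W t).
  by move=> s t s0 st; apply: rather_belowU; [exact: sV|exact: sW].
apply: le_anti; rewrite leUx; apply/andP; split; last first.
  apply: fsup_le => _ [t t0 ->]; rewrite leU2 //; apply: fsup_ub; by exists t.
apply/andP; split; apply: fsup_le => _ [t t0 ->].
  by apply: le_trans (leUl _ (W t)) _; apply: fsup_ub; exists t.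
by apply: le_trans (leUr _ (V t)) _; apply: fsup_ub; exists t.
Qed.

Lemma Coz_complemented a : complemented a -> Coz a.
Proof.
move=> ca; apply/CozP; exists (fun=> a).
  by move=> s t _ _; exact: complemented_rather_below.
apply: le_anti; apply/andP; split; last by apply: fsup_le => _ [t _ ->].
by apply: fsup_ub; exists 1.
Qed.

Lemma Coz_up phi p : Coz (RL_up phi p).
Proof.
apply/CozP; exists (fun t => RL_up phi (p + t)).
  by move=> s t s0 st; apply: RL_up_rather_below; lra.
rewrite RL_upE; congr fsup; rewrite eqEsubset; split=> [_ [r r0 ->]|_ [t t0 ->]].
  by exists (r - p); [lra|congr RL_up; lra].
by exists (p + t)%R => //; lra.
Qed.

Lemma Coz_dn phi q : Coz (RL_dn phi q).
Proof.
apply/CozP; exists (fun t => RL_dn phi (q - t)).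
  by move=> s t s0 st; apply: RL_dn_rather_below; lra.
rewrite RL_dnE; congr fsup; rewrite eqEsubset; split=> [_ [r r0 ->]|_ [t t0 ->]].
  by exists (q - r); [lra|congr RL_dn; lra].
by exists (q - t)%R => //; lra.
Qed.

End Cozero.

(** * Regular elements and ideals of reduced rings *)

Section ReducedRing.
Local Open Scope classical_set_scope.
Local Open Scope ring_scope.
Variable R : comPzRingType.
Implicit Types (f g h x y z : R) (I J P Q : set R).

(** Von Neumann regularity: [f * h] is then an idempotent generating the same ideal as [f]. *)
Definition regular f : Prop := exists h, f = f * f * h.

Lemma regularM_idem f h : f = f * f * h -> (f * h) * (f * h) = f * h.
Proof. by move=> e; rewrite mulrACA mulrA -e. Qed.

Lemma is_idealN I x : is_ideal I -> I x -> I (- x).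
Proof. by move=> [_ _ IM] Ix; rewrite -mulN1r; exact: IM. Qed.

Lemma is_idealB I x y : is_ideal I -> I x -> I y -> I (x - y).
Proof. by move=> iI Ix Iy; case: (iI) => _ ID _; apply: ID => //; exact: is_idealN. Qed.

Lemma principal_is_ideal f : is_ideal (principal_ideal f).
Proof.
split=> [|_ _ [r _ <-] [s _ <-]|s _ [r _ <-]].
- by exists 0; rewrite ?mul0r.
- by exists (r + s) => //; rewrite mulrDl.
- by exists (s * r) => //; rewrite mulrA.
Qed.

Lemma principal_ideal_id f : principal_ideal f f.
Proof. by exists 1; rewrite ?mul1r. Qed.

Lemma principal_ideal0 : principal_ideal (0 : R) = [set 0].
Proof.
by rewrite eqEsubset; split=> [_ [r _ <-]|_ ->]; [rewrite mulr0|exists 0; rewrite ?mulr0].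
Qed.

Lemma ideal_mul_in I J x y : I x -> J y -> ideal_mul I J (x * y).
Proof.
move=> Ix Jy; exists [:: (x, y)]; rewrite big_seq1; split=> // p.
by rewrite inE => /eqP ->.
Qed.

Lemma ideal_mul_sub I J K : is_ideal K -> (forall x y, I x -> J y -> K (x * y)) ->
  ideal_mul I J `<=` K.
Proof.
move=> [K0 KD _] h _ [s [sIJ ->]]; rewrite big_seq; elim/big_ind: _ => //.
by move=> p /sIJ[]; exact: h.
Qed.

Lemma ideal_mul_principal f g :
  ideal_mul (principal_ideal f) (principal_ideal g) = principal_ideal (f * g).
Proof.
rewrite eqEsubset; split.
  apply: ideal_mul_sub; first exact: principal_is_ideal.
  by move=> _ _ [r _ <-] [s _ <-]; exists (r * s) => //; ring.
move=> _ [r _ <-]; rewrite mulrA; apply: ideal_mul_in; first by exists r.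
exact: principal_ideal_id.
Qed.

Lemma ideal_powX J n x : J x -> ideal_pow J n.+1 (x ^+ n.+1).
Proof.
by move=> Jx; elim: n => [//|n IH]; rewrite exprSr; exact: ideal_mul_in IH Jx.
Qed.

Lemma semiprime_sqr I x : semiprime I -> I (x * x) -> I x.
Proof.
move=> [[iI _] sI] Ixx; apply: (sI (principal_ideal x) 2%N) => //.
- exact: principal_is_ideal.
- rewrite /= ideal_mul_principal => _ [r _ <-]; by case: iI => _ _; apply.
- exact: principal_ideal_id.
Qed.

Hypothesis reducedR : forall x, x * x = 0 -> x = 0.

(** For a positive exponent [n], the square of [x ^+ n] is a multiple of [x ^+ n.+1], so the
    exponent can be lowered one at a time. *)
Lemma reducedX x n : x ^+ n = 0 -> x = 0.
Proof.
have [m] := ubnP n; elim: m n => // m IH [|[|n]] lt.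
- by rewrite expr0 => e; rewrite -[x]mul1r e mul0r.
- by rewrite expr1.
- move=> e; apply: (IH n.+1) => //; apply: reducedR.
  by rewrite -exprD addSnnS exprD e mulr0.
Qed.

(** The square of [f - f * f * h] has the vanishing factor [f * f - f * f * f * h]. *)
Lemma regular_sqr f h : f * f = f * f * f * h -> regular f.
Proof.
move=> e; exists h; apply/subr0_eq; apply: reducedR.
have -> : (f - f * f * h) * (f - f * f * h) = (f * f - f * f * f * h) * (1 - f * h).
  by ring.
by rewrite -e subrr mul0r.
Qed.

Lemma regular0 : regular 0.
Proof. by exists 0; rewrite !mulr0. Qed.

(** The element [1 - f * h] annihilates [f]. If a power of [x] is a multiple of [f], then
    [x * (1 - f * h)] is nilpotent, hence zero, and [x = x * h * f]. *)
Lemma semiprime_regular f : regular f -> principal_ideal f <> setT ->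
  semiprime (principal_ideal f).
Proof.
move=> [h e] nT; split; first by split=> //; exact: principal_is_ideal.
move=> J [//|n] iJ _ Jn x Jx; have [r _ rx] := Jn _ (ideal_powX n Jx).
exists (x * h) => //; apply/esym/subr0_eq.
have -> : x - x * h * f = x * (1 - f * h) by ring.
apply: (@reducedX _ n.+1); rewrite exprMn -rx exprS mulrA.
have -> : r * f * (1 - f * h) = r * (f - f * f * h) by ring.
by rewrite -e subrr mulr0 mul0r.
Qed.

(** Semiprime ideals are proper, so a unit [f] needs separate care: [g] then generates the same
    ideal as [f * g], which is proper, and inherits regularity. *)
Lemma regular_semiprimeU f g : regular f -> regular (f * g) ->
  principal_ideal (f * g) <> setT ->
  semiprime (principal_ideal f) \/ semiprime (principal_ideal g).
Proof.
move=> rf [h e] nfg; have [fT|nT] := pselect (principal_ideal f = setT); last first.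
  by left; exact: semiprime_regular.
have [s _ sf] : principal_ideal f 1 by rewrite fT.
have gE x : x * g = x * s * (f * g).
  have -> : x * s * (f * g) = x * g * (s * f) by ring.
  by rewrite sf mulr1.
right; apply: semiprime_regular.
  exists (f * h); rewrite -[LHS]mul1r gE mul1r e.
  have -> : s * (f * g * (f * g) * h) = g * g * (f * h) * (s * f) by ring.
  by rewrite sf mulr1.
move=> gT; apply: nfg; rewrite -subTset => x _.
have [r _ <-] : principal_ideal g x by rewrite gT.
by rewrite (gE r); exists (r * s).
Qed.

Lemma principal_ideal_cap0 f g :
  (principal_ideal f `&` principal_ideal g = [set 0]) <-> f * g = 0.
Proof.
split=> [e|fg0].
  have : (principal_ideal f `&` principal_ideal g) (f * g).
    by split; [exists g => //; rewrite mulrC|exists f].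
  by rewrite e.
rewrite eqEsubset; split=> [x [[r _ rx] [s _ sx]]|_ ->]; last first.
  by split; exists 0; rewrite ?mul0r.
apply: reducedR; rewrite -{1}rx -sx.
have -> : r * f * (s * g) = r * s * (f * g) by ring.
by rewrite fg0 mulr0.
Qed.

(** The exponent is odd so that functions of either sign have roots. *)
Definition has_cube_roots : Prop := forall f, exists c, c * c * c = f.

Lemma semiprime_cube_root I c : semiprime I -> I (c * c * c) -> I c.
Proof.
move=> sI Ic; apply: (semiprime_sqr sI); apply: (semiprime_sqr sI).
have -> : c * c * (c * c) = c * (c * c * c) by ring.
by case: sI => -[[_ _ +] _] _; apply.
Qed.

(** A cube root [c] of [f * g] lies in the intersection, say [c = r * f = s * g]. Then the square of
    [f * g], which is the sixth power of [c], equals the cube of [f * g] times the cube of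
    [r * s]. *)
Lemma semiprime_capP f g : has_cube_roots ->
  semiprime (principal_ideal f `&` principal_ideal g) -> regular (f * g).
Proof.
move=> /(_ (f * g))[c cE] sI.
have [[r _ rf] [s _ sg]] : (principal_ideal f `&` principal_ideal g) c.
  apply: (semiprime_cube_root sI); rewrite cE; split; last by exists f.
  by exists g => //; rewrite mulrC.
apply: (@regular_sqr _ ((r * s) ^+ 3)).
have e : f * g * (f * g) = r * f * (r * f) * (r * f) * (s * g * (s * g) * (s * g)).
  by rewrite rf sg cE.
by rewrite {1}e; ring.
Qed.

Lemma semiprime_regularP f : has_cube_roots ->
  semiprime (principal_ideal f) -> regular f.
Proof.
move=> cr sf; have [|h e] := @semiprime_capP f f cr; first by rewrite setIid.
by apply: (@regular_sqr _ (f * h)); rewrite {1}e; ring.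
Qed.

End ReducedRing.

(** * Prime ideals, [P]-ideals and von Neumann regularity *)

Section PIdeals.
Local Open Scope classical_set_scope.
Local Open Scope ring_scope.
Variable R : comPzRingType.
Implicit Types (f g h x y z : R) (I J P Q S : set R).

Definition prime_ideal P : Prop :=
  is_ideal P /\ forall x y, P (x * y) -> P x \/ P y.

(** The members of the chain may be empty, so that the union of the empty chain
    is one of them; a maximal member contains [0]. *)
Lemma prime_avoiding S : ~ S 0 -> (exists s, S s) ->
  (forall x y, S x -> S y -> S (x * y)) ->
  exists2 P, prime_ideal P & forall x, P x -> ~ S x.
Proof.
move=> S0 [s Ss] SM.
pose E X := [/\ forall x y, X x -> X y -> X (x + y),
  forall r x, X x -> X (r * x) & forall x, X x -> ~ S x].
have [F FE Ftot|A [[AD AM AS] Amax]] := @Zorn_bigcup R E.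
  split=> [x y [X FX Xx] [Y FY Yy]|r x [X FX Xx]|x [X FX Xx]].
  - have [XY|YX] := Ftot X Y FX FY.
      by exists Y => //; have [+ _ _] := FE _ FY; apply=> //; exact: XY.
    by exists X => //; have [+ _ _] := FE _ FX; apply=> //; exact: YX.
  - by exists X => //; have [_ + _] := FE _ FX; apply.
  - by have [_ _] := FE _ FX; apply.
have A0 : A 0.
  apply: contrapT => nA0; apply: (Amax [set 0]); last first.
    by split=> [x y -> ->|r x ->|x ->//]; rewrite /= ?addr0 ?mulr0.
  have nA x : ~ A x by move=> /(AM 0); rewrite mul0r.
  by split=> [x /nA//|/(_ 0 erefl)].
(* By maximality, adjoining to [A] an element outside it produces an ideal that meets [S]. *)
have meetS x : ~ A x -> exists a r, A a /\ S (a + r * x).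
  move=> nAx; pose B := [set z | exists a r, A a /\ z = a + r * x].
  have AB : A `<` B.
    split=> [a Aa|BA]; first by exists a, 0; rewrite mul0r addr0.
    by apply: nAx; apply: BA; exists 0, 1; rewrite mul1r add0r.
  apply: contrapT => no; apply: (Amax B AB); split.
  - move=> _ _ [a [r [Aa ->]]] [b [q [Ab ->]]]; exists (a + b), (r + q).
    by split; [exact: AD|ring].
  - move=> q _ [a [r [Aa ->]]]; exists (q * a), (q * r).
    by split; [exact: AM|ring].
  - by move=> _ [a [r [Aa ->]]] Sx; apply: no; exists a, r.
exists A => //; split; first by split.
move=> x y Axy; apply: contrapT => /not_orP[/meetS[a [r [Aa Sa]]] /meetS[b [q [Ab Sb]]]].
apply: (AS _ _ (SM _ _ Sa Sb)).
have -> : (a + r * x) * (b + q * y) = (b + q * y) * a + (r * x * b + r * q * (x * y)).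
  by ring.
apply: (AD); first exact: AM.
by apply: (AD); exact: AM.
Qed.

Lemma rng_ideal_setI I P : is_ideal I -> is_ideal P -> rng_ideal I (P `&` I).
Proof.
move=> iI iP; split.
- by move=> x [].
- by split; [case: iP|case: iI].
- by move=> x y [Px Ix] [Py Iy]; split; exact: is_idealB.
- by move=> r x Ir [Px Ix]; split; [case: iP => _ _|case: iI => _ _]; apply.
Qed.

Hypothesis reducedR : forall x, x * x = 0 -> x = 0.

Lemma P_ideal_regular I f : P_ideal I -> I f -> regular f.
Proof.
move=> [iI [->|PI]] If; first by rewrite If; exact: regular0.
apply: contrapT => nreg.
(* Closed under products, as [(1 - f * h) * (1 - f * k) = 1 - f * (h + k - f * h * k)]. It contains
   zero only if [f * (1 - f * h)] is nilpotent for some [h], which would make [f] regular. *)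
pose S := [set z | exists n h, z = f ^+ n * (1 - f * h)].
have [||| P [iP Pp] PS] := @prime_avoiding S.
- move=> [n [h e]]; apply: nreg; exists h; apply: subr0_eq.
  have -> : f - f * f * h = f * (1 - f * h) by ring.
  apply: (@reducedX _ reducedR _ n.+1).
  have -> : (f * (1 - f * h)) ^+ n.+1 = f ^+ n * (1 - f * h) * (f * (1 - f * h) ^+ n).
    by rewrite exprMn !exprS; ring.
  by rewrite -e mul0r.
- by exists 1, 0%N, 0; rewrite expr0; ring.
- move=> _ _ [n [h ->]] [m [k ->]]; exists (n + m)%N, (h + k - f * h * k).
  by rewrite exprD; ring.
have PIprime : rng_prime I (P `&` I).
  split; first exact: rng_ideal_setI.
    move=> e; have [Pf _] : (P `&` I) f by rewrite e.
    by apply: (PS _ Pf); exists 1%N, 0; ring.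
  by move=> x y Ix Iy [/Pp[Px|Py] _]; [left|right].
(* The ideal generated by [P] and [f * f], cut down to [I], lies strictly between: it contains
   [f * f], which is in [S], but not [f], since [f = p + r * (f * f)] would put
   [p = f * (1 - f * r)] in both [P] and [S]. *)
have [_ _ /(_ ((fun z => exists p r, P p /\ z = p + r * (f * f)) `&` I))] := PI _ PIprime.
have [P0 PD PM] := iP.
case.
- apply: rng_ideal_setI => //; split.
  + by exists 0, 0; split=> //; ring.
  + move=> _ _ [p [r [Pp1 ->]]] [q [s [Pq ->]]]; exists (p + q), (r + s).
    by split; [exact: PD|ring].
  + by move=> s _ [p [r [Pp1 ->]]]; exists (s * p), (s * r); split; [exact: PM|ring].
- by move=> x [Px Ix]; split=> //; exists x, 0; split=> //; ring.
- move=> e; have [Pff _] : (P `&` I) (f * f).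
    rewrite -e; split; last by case: iI => _ _; apply.
    by exists 0, 1; split=> //; ring.
  by apply: (PS _ Pff); exists 2%N, 0; ring.
- move=> e; have : I f by [].
  rewrite -{1}e => -[[p [r [Pp1 fE]]] _]; apply: (PS _ Pp1); exists 1%N, r.
  have -> : p = f - r * (f * f) by rewrite {1}fE; ring.
  by ring.
Qed.

(** If [Q] contains [P] and some [x] outside [P], it contains the idempotent [x * h]. For [y] in
    [I], the rest [y - y * (x * h)] is annihilated by [x], so it lies in [P], and [y] lies in
    [Q]. *)
Lemma regular_P_ideal I : is_ideal I -> (forall f, I f -> regular f) -> P_ideal I.
Proof.
move=> iI reg; split=> //; right=> P [iP PI Pprime]; split=> // Q [QI Q0 QB QM] PQ.
have [QP|] := pselect (Q `<=` P); first by left; rewrite eqEsubset.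
move=> /existsNP[x /not_implyP[Qx nPx]]; right; rewrite eqEsubset; split=> // y Iy.
have Ix := QI _ Qx; have [h e] := reg x Ix; have [I0 ID IM] := iI.
(* The factor [h] need not be in [I], but [x * (h * h)] is, and [Q] absorbs that. *)
have Qe : Q (x * h).
  have -> : x * h = x * (h * h) * x by rewrite -{1}(regularM_idem e); ring.
  by apply: QM => //; rewrite mulrC; exact: IM.
have Qye : Q (y * (x * h)) by exact: QM.
have [_ P0 _ _] := iP.
have [||Pe|//] := Pprime (y - y * (x * h)) x _ Ix.
- by apply: is_idealB => //; rewrite mulrC; apply: IM.
- have -> : (y - y * (x * h)) * x = y * (x - x * x * h) by ring.
  by rewrite -e subrr mulr0.
- have -> : y = (y - y * (x * h)) - (0 - y * (x * h)) by ring.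
  by apply: (QB) => //; [exact: PQ|exact: QB].
Qed.

End PIdeals.

(** * Regular elements and cube roots in [RL L] *)

Section RegularElements.
Context {d : Order.disp_t} {L : frameType d}.
Implicit Types (phi psi f g u : RL L) (a b w v : L) (p q r s t : rat).

(** The complement is the cozero element of [1 - f * h], whose product with [f] is zero and whose
    sum with [f * h] is one. *)
Lemma regular_complemented f : regular f -> complemented (coz f).
Proof.
move=> [h e]; apply/complementedP; exists (coz (1 - f * h)%R); split.
  rewrite -cozM -coz0; congr coz.
  have -> : (f * (1 - f * h) = f - f * f * h)%R by ring.
  by rewrite -e subrr.
have e1 : (f * h + (1 - f * h) = 1 :> RL L)%R by ring.
apply: le_anti; rewrite lex1 -coz1 -{1}e1 /=.
by apply: le_trans (cozD _ _) _; rewrite leU2 // cozM leIl.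
Qed.

Lemma coz_off phi w v p q : w `&` coz phi = \bot -> w <= phi (LR_gen p q) ->
  (p < 0 -> 0 < q -> w <= v) -> w <= v.
Proof.
move=> w0 wpq h; rewrite -(joinx0 v) -w0 joinIr lexI leUr /=.
apply: (coz_cases wpq) (leUr _ _) => p0 q0.
by apply: le_trans (leUl _ _); exact: h.
Qed.

(** [k] is [1 / u] on [coz u] and [0] off it. *)
Lemma complemented_recip u : complemented (coz u) -> RL_dn u 0 = \bot ->
  exists k, (u = u * (u * k))%R.
Proof.
set a := coz u => ca u0.
have ua : RL_up u 0 = a by rewrite /a cozE u0 join0x.
(* For positive [t], the inequality [1 / u > t] on [a] reads [u < 1 / t]. *)
pose V t : L := if t <= 0 then \top else a `&` RL_dn u t^-1.
have V0 t : 0 < t -> V t = a `&` RL_dn u t^-1 by rewrite /V leNgt => ->.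
have [||| k [U D]] := @RL_scale _ _ V.
- move=> s t st; case: (ltP 0 s) => s0; last first.
    by rewrite {2}/V s0; exists \bot; rewrite meetx0 joinx1.
  rewrite !V0 //; last exact: lt_trans st.
  apply: rather_belowI; first exact: complemented_rather_below.
  by apply: RL_dn_rather_below; rewrite ltf_pV2 ?posrE //; exact: lt_trans st.
- by apply: le_anti; rewrite lex1; apply: fsup_ub; exists 0; rewrite /V lexx.
- apply: le_anti; rewrite lex1 /= -ca leUx; apply/andP; split; last first.
    apply: (@le_trans _ _ (pcompl (V 1))); last by apply: fsup_ub; exists 1.
    by apply: pcompl_le; rewrite V0 // leIl.
  rewrite -ua RL_upE; apply: fsup_le => _ [r r0 ->].
  apply: (@le_trans _ _ (pcompl (V r^-1))); last by apply: fsup_ub; exists r^-1.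
  rewrite V0 ?invr_gt0 // invrK; apply: le_trans (up_le_pcompl _ (lexx r)) _.
  by apply: pcompl_le; exact: leIr.
(* This says that [u * k] is one on [a]: the intervals of [u] and [k] at a nonzero part of [a]
   contain reciprocal rationals. *)
have recip w p q r s : w <= a -> w <= u (LR_gen p q) -> w <= k (LR_gen r s) ->
    (forall x y : rat, p < x -> x < q -> r < y -> y < s -> (x * y)%R = 1 -> False) ->
    w <= \bot.
  rewrite RL_genE (RL_genE k) !lexI => wa /andP[wp wq] /andP[wr ws] no.
  rewrite -[leLHS]meetxx; apply: le_trans (leI2 wr (lexx _)) _.
  rewrite -[X in _ `&` X]meetxx meetA.
  apply: le_trans (leI2 (leI2 (lexx _) ws) (lexx _)) _.
  rewrite U D meetC; apply: le_trans (le0x _).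
  rewrite meetA; apply: fsup_meet_le => _ [sg sgs ->].
  rewrite meetAC; apply: fsup_meet_le => _ [ta tar ->].
  set v := _ `&` _ `&` _.
  have vw : v <= w by apply: le_trans (leIl _ _) (leIl _ _).
  have vV : v <= V ta by exact: leIr.
  have vV' : v <= pcompl (V sg) by apply: le_trans (leIl _ _) (leIr _ _).
  case: (leP sg 0) => sg0.
    by apply: le_trans vV' _; rewrite /V sg0 -[leLHS]meet1x meet_pcompl.
  have s0 : 0 < s by exact: lt_trans sgs.
  have isg : s^-1 < sg^-1 by rewrite ltf_pV2.
  have is0 : 0 < s^-1 by rewrite invr_gt0.
  (* Below [v] the function [k] is at most [sg], so [u] exceeds every rational below [1 / sg]; one
     above [1 / s] is chosen, to force the reciprocal below [s]. *)
  pose rho := (s^-1 + sg^-1) / 2%:R.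
  have rho1 : s^-1 < rho by rewrite /rho; lra.
  have rho2 : rho < sg^-1 by rewrite /rho; lra.
  have vrho : v <= RL_up u rho.
    rewrite -[leLHS]meetx1 -(RL_up_dn1 u rho2) meetUr leUx leIr /=.
    apply: le_trans (le0x _); rewrite -(meet_pcompl (V sg)) lexI; apply/andP; split.
      by rewrite V0 // leI2 //; exact: le_trans vw wa.
    exact: le_trans (leIl _ _) vV'.
  (* For [ta <= 0] no upper bound on [u] is needed, as a positive reciprocal already exceeds [r]. *)
  pose e := if ta <= 0 then q else Order.min q ta^-1.
  have vu : v <= u (LR_gen (Order.max p rho) e).
    rewrite RL_genE lexI; apply/andP; split.
      by case: (leP p rho) => // _; exact: le_trans vw wp.
    rewrite /e; move: vV; rewrite /V; case: (leP ta 0) => [_ _|_].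
      exact: le_trans vw wq.
    rewrite lexI => /andP[_ vt]; case: (leP q ta^-1) => // _.
    exact: le_trans vw wq.
  apply: (RL_elim vu) => x; rewrite gt_max => /andP[px rx] xe.
  have x0 : 0 < x by lra.
  have ix0 : 0 < x^-1 by rewrite invr_gt0.
  exfalso; apply: (no x x^-1) => //.
  - by move: xe; rewrite /e; case: (ta <= 0) => //; rewrite lt_min => /andP[].
  - move: xe; rewrite /e; case: (leP ta 0) => [ta0 _|ta0].
      exact: lt_trans tar (le_lt_trans ta0 ix0).
    rewrite lt_min => /andP[_ xt]; apply: lt_trans tar _.
    by rewrite -(invrK ta) ltf_pV2 ?posrE ?invr_gt0.
  - by rewrite -(invrK s) ltf_pV2 ?posrE //; lra.
  - by rewrite divff // gt_eqF.
exists k; apply: RL_eqP => w p q r s w1 w2 no.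
apply: (RL_mul_elim w2) => w3 r1 s1 t1 u1 l1 h1 h2 b1.
apply: (RL_mul_elim h2) => w4 r2 s2 t2 u2 l2 h3 h4 b2.
have hu := RL_cap (RL_cap (le_trans (le_trans l2 l1) w1) (le_trans l2 h1)) h3.
have agree x y : Order.max (Order.max p r1) r2 < x ->
    x < Order.min (Order.min q s1) s2 -> t2 < y -> y < u2 ->
    (x * (x * y))%R = x -> False.
  rewrite !gt_max !lt_min => /andP[/andP[a1 a2] a3] /andP[/andP[a4 a5] a6] a7 a8.
  have [a9 a10] := b2 x y a3 a6 a7 a8; have := b1 x _ a2 a5 a9 a10.
  by move=> + e; rewrite e => -[a11 a12]; exact: (no x).
(* On [coz u] the points are [x] and its reciprocal; on the complement [u] is zero, and any value of
   [k] will do. *)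
rewrite -[leLHS]meetx1 -ca meetUr leUx; apply/andP; split.
  apply: (recip _ _ _ _ _ (leIr _ _) (le_trans (leIl _ _) hu) (le_trans (leIl _ _) h4)).
  by move=> x y x1 x2 y1 y2 xy; apply: (agree x y) => //; rewrite xy mulr1.
apply: (@coz_off u _ _ _ _ _ (le_trans (leIl _ _) hu)) => [|p0 q0].
  by rewrite -meetA [_ `&` coz u]meetC meet_pcompl meetx0.
apply: (RL_elim (le_trans (leIl _ _) h4)) => y y1 y2.
by exfalso; apply: (agree 0 y) => //; rewrite mul0r.
Qed.

(** The square of [f] is nonnegative with the same cozero element, so its reciprocal [k] exists, and
    the square of [f] is its cube times [f * k]. *)
Lemma complemented_regular f : complemented (coz f) -> regular f.
Proof.
move=> cf; have [||k e] := @complemented_recip (f * f)%R.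
- by rewrite cozM meetxx.
- exact: RL_dn_sqr.
by apply: (@regular_sqr _ (@RL_reduced _ L) _ (f * k)%R); rewrite {1}e; ring.
Qed.

Lemma regularP f : regular f <-> complemented (coz f).
Proof. by split; [exact: regular_complemented|exact: complemented_regular]. Qed.

Let cube t : rat := (t * t * t)%R.

Let cube_lt s t : s < t -> cube s < cube t.
Proof.
rewrite /cube => st; rewrite -subr_gt0.
have -> : (t * t * t - s * s * s =
    (t - s) * ((t - s) ^+ 2 / 4%:R + 3%:R / 4%:R * (t + s) ^+ 2))%R by field.
have ts : 0 < t - s by rewrite subr_gt0.
rewrite mulr_gt0 // ltr_wpDr //; last by rewrite divr_gt0 ?exprn_gt0.
by rewrite mulr_ge0 ?sqr_ge0.
Qed.

Let cube_ltE s t : cube s < cube t -> s < t.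
Proof.
case: (ltgtP s t) => // [/cube_lt ts|->]; last by rewrite ltxx.
by rewrite ltNge (ltW ts).
Qed.

Let cube_dense s t : s < t -> exists y, s < cube y /\ cube y < t.
Proof.
(* A walk from [- M] in steps of [dl] stops at the first point whose cube exceeds [s]. Within these
   bounds a step raises the cube by less than [12 * M * M * dl = t - s], so that cube is still below
   [t]. *)
move=> st; pose M : rat := `|s| + `|t| + 1.
have [Ms Mt] : - M + 1 <= s /\ t <= M - 1.
  have := ler_norm t; have := ler_norm (- s); rewrite normrN.
  by have := normr_ge0 t; have := normr_ge0 s; rewrite /M; split; lra.
have M1 : 1 <= M by have := normr_ge0 t; have := normr_ge0 s; rewrite /M; lra.
pose dl : rat := (t - s) / (12%:R * M * M).
have dl0 : 0 < dl by rewrite divr_gt0 ?subr_gt0 ?mulr_gt0 //; lra.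
have dlE : (dl * (12%:R * M * M))%R = (t - s)%R.
  by rewrite divfK // gt_eqF // !mulr_gt0 //; lra.
have dl1 : dl <= M by nra.
have exn : exists n : nat, s < cube (- M + n%:R * dl).
  exists (Num.bound (2%:R * M / dl)).
  have := archi_boundP (ltW (divr_gt0 (_ : 0 < 2%:R * M) dl0)).
  rewrite ltr_pdivrMr // => /(_ _) h; apply: (@lt_le_trans _ _ (cube M)).
    rewrite /cube; nra.
  by apply/ltW/cube_lt; have := h; lra.
have := ex_minnP exn; case=> -[|n] sn minn.
  by exfalso; move: sn; rewrite mul0r addr0 /cube; nra.
exists (- M + n.+1%:R * dl)%R; split=> //.
have : cube (- M + n%:R * dl) <= s by rewrite leNgt; apply/negP => /minn; rewrite ltnn.
have : 0 <= n%:R * dl by rewrite mulr_ge0 ?ler0n // ltW.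
rewrite -natr1 mulrDl mul1r addrA; move: (n%:R * dl)%R => z z0.
have -> : (- M + z + dl = (- M + z) + dl)%R by [].
have : - M <= - M + z by lra.
move: (- M + z)%R => y My ys.
have yM : y < M by apply: cube_ltE; apply: le_lt_trans ys _; rewrite /cube; nra.
have -> : cube (y + dl) = (cube y + dl * (3%:R * y * y + 3%:R * y * dl + dl * dl))%R.
  by rewrite /cube; ring.
have h : 3%:R * y * y + 3%:R * y * dl + dl * dl < 12%:R * M * M by nra.
have := ltr_pM2l dl0 (3%:R * y * y + 3%:R * y * dl + dl * dl)%R (12%:R * M * M)%R.
rewrite h dlE; move: (dl * (3%:R * _ * _ + _ + _))%R => z' ?; lra.
Qed.

(** The scale of the root at [t] is the upper ray of [phi] at the cube of [t]. *)
Lemma RL_cube_roots : has_cube_roots (RL L).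
Proof.
move=> phi; have cube_ge (t : rat) : 1 <= t -> t <= cube t by rewrite /cube; nra.
have cube_le (t : rat) : t <= - 1 -> cube t <= t by rewrite /cube; nra.
have [||| c [U D]] := @RL_scale _ _ (fun t => RL_up phi (cube t)).
- by move=> s t st; apply: RL_up_rather_below; exact: cube_lt.
- apply: le_anti; rewrite lex1 -(RL_up_cover phi); apply: fsup_le => _ [p ->].
  apply: (@le_trans _ _ (RL_up phi (cube (- (`|p| + 1))))).
    have := ler_norm (- p); rewrite normrN => np; have := normr_ge0 p => p0.
    apply: RL_up_le; apply: le_trans (cube_le _ _) _; lra.
  by apply: fsup_ub; eexists.
- apply: le_anti; rewrite lex1 -(RL_dn_cover phi); apply: fsup_le => _ [p ->].
  apply: (@le_trans _ _ (pcompl (RL_up phi (cube (`|p| + 1))))).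
    have := ler_norm p => np; have := normr_ge0 p => p0.
    apply: dn_le_pcompl; apply: le_trans _ (cube_ge _ _); lra.
  by apply: fsup_ub; eexists.
have cphi w p q : w <= c (LR_gen p q) -> w <= phi (LR_gen (cube p) (cube q)).
  move=> /le_trans; apply; rewrite !RL_genE U D leI2 //.
    by apply: fsup_le => _ [t pt ->]; apply: RL_up_le; apply/ltW/cube_lt.
  by apply: fsup_le => _ [t pt ->]; apply: pcompl_up_le; exact: cube_lt.
exists c; apply: RL_eqP => w p q r s w1 w2 no.
apply: (RL_mul_elim w1) => w3 r1 s1 t1 u1 l1 h1 /cphi h2 b1.
apply: (RL_mul_elim h1) => w4 r2 s2 t2 u2 l2 /cphi h3 /cphi h4 b2.
have l := le_trans l2 l1.
apply: (RL_elim (RL_cap (RL_cap h3 h4) (RL_cap (le_trans l2 h2) (le_trans l w2)))).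
(* A rational in the common interval need not have a rational cube root, so density supplies a cube
   there. *)
move=> x x1 x2; have [y] := cube_dense (lt_trans x1 x2).
rewrite !gt_max !lt_min.
move=> -[/andP[/andP[/cube_ltE a1 /cube_ltE a2] /andP[/cube_ltE a3 a4]]].
move=> /andP[/andP[/cube_ltE a5 /cube_ltE a6] /andP[/cube_ltE a7 a8]].
have [a9 a10] := b2 y y a1 a5 a2 a6; have [a11 a12] := b1 _ y a9 a10 a3 a7.
by case: (no (cube y)).
Qed.

End RegularElements.

(** * [C*]-quotients and [F]-frames *)

Section Extension.
Context {d : Order.disp_t} {L : frameType d}.
Variable a : L.
Implicit Types (x y : downset a) (b w v : L) (p q r s t : rat).

Lemma down_valI x y : val (x `&` y) = val x `&` val y.
Proof. by []. Qed.

Lemma down_val0 : val (\bot : downset a) = \bot.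
Proof.
apply: le_anti; rewrite le0x andbT.
have : (\bot : downset a) <= Downset (le0x a) by exact: le0x.
by [].
Qed.

Lemma down_valU x y : val (x `|` y) = val x `|` val y.
Proof.
have xy : val x `|` val y <= a by rewrite leUx !down_valP.
apply: le_anti; apply/andP; split.
  have : x `|` y <= Downset xy by rewrite leUx !down_leE /= leUl leUr.
  by [].
by rewrite leUx -!down_leE leUl leUr.
Qed.

(** A witness in the down-set reaches only up to [a]; joined with a witness for [b] and [c], it
    reaches the top of [L]. *)
Lemma down_rather_below b c x y : rather_below b c -> c <= a ->
  rather_below x y -> rather_below (b `&` val x) (c `&` val y).
Proof.
move=> [t [bt tc]] ca [z [/(congr1 val) xz /(congr1 val) zy]].
rewrite down_valI down_val0 in xz; rewrite down_valU in zy.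
exists (t `|` val z); split.
  by rewrite meetUr meetAC bt meet0x -meetA xz meetx0 joinxx.
rewrite joinIr joinAC tc join1x meet1x -joinA zy.
by apply: le_anti; rewrite lex1 -tc leU2.
Qed.

Lemma Coz_down x : Coz a -> Coz x -> Coz (val x).
Proof.
move=> /CozP[A sA aE] /CozP[X sX ->]; apply/CozP.
exists (fun t => A t `&` val (X t)).
  move=> s t s0 st; apply: down_rather_below; [exact: sA| |exact: sX].
  by rewrite aE; apply: fsup_ub; exists s.
apply: le_anti; apply/andP; split; last first.
  apply: fsup_le => _ [t t0 ->]; apply: le_trans (leIr _ _) _.
  by apply: fsup_ub; exists (X t) => //; exists t.
rewrite -[leLHS](meet_idPr (down_valP _)) [X in X `&` _ <= _]aE.
apply: fsup_meet2_le => _ _ [t t0 ->] [_ [s s0 ->] <-].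
have m0 : 0 < Order.min t s by rewrite lt_min t0 s0.
apply: (@le_trans _ _ (A (Order.min t s) `&` val (X (Order.min t s)))); last first.
  by apply: fsup_ub; exists (Order.min t s).
rewrite leI2 //; first by apply: cozero_scale_le => //; rewrite ge_min lexx.
by rewrite -down_leE; apply: cozero_scale_le => //; rewrite ge_min lexx orbT.
Qed.

Lemma RL_up_down (psi : RL L) (phi : RL (downset a)) p :
  (forall u, phi u = down_proj a (psi u)) -> a `&` RL_up psi p = val (RL_up phi p).
Proof.
move=> e; apply: le_anti; apply/andP; split.
  apply: fsup_meet_le => _ [q ->]; have := RL_le_up phi p q.
  by rewrite e down_leE.
apply: fsup_le => _ [_ [q ->] <-]; rewrite e /= leI2 //; exact: RL_le_up.
Qed.

Lemma RL_dn_down (psi : RL L) (phi : RL (downset a)) q :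
  (forall u, phi u = down_proj a (psi u)) -> a `&` RL_dn psi q = val (RL_dn phi q).
Proof.
move=> e; apply: le_anti; apply/andP; split.
  apply: fsup_meet_le => _ [p ->]; have := RL_le_dn phi p q.
  by rewrite e down_leE.
apply: fsup_le => _ [_ [p ->] <-]; rewrite e /= leI2 //; exact: RL_le_dn.
Qed.

(** For [p < t], [a] is covered by [{phi > p}] and [{phi < t}], and [V t] misses the latter; so on
    [a] the rays built from [V] are those of [phi]. *)
Lemma down_scale_extend (phi : RL (downset a)) (V : rat -> L) :
  (forall s t, s < t -> rather_below (V t) (V s)) ->
  (exists t, V t = \top) -> (exists t, V t = \bot) ->
  (forall t, val (RL_up phi t) <= V t) ->
  (forall t, V t <= pcompl (val (RL_dn phi t))) ->
  exists psi : RL L, forall u, phi u = down_proj a (psi u).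
Proof.
move=> sV [hi Vhi] [lo Vlo] upV Vdn.
have updn p q : p < q -> a = val (RL_up phi p) `|` val (RL_dn phi q).
  by move=> pq; rewrite -down_valU RL_up_dn1.
have [//||| psi [U D]] := @RL_scale _ _ V.
- by apply: le_anti; rewrite lex1 /= -Vhi; apply: fsup_ub; exists hi.
- apply: le_anti; rewrite lex1 /=; apply: (@le_trans _ _ (pcompl (V lo))).
    by rewrite Vlo; apply: le_pcompl; rewrite meetx0.
  by apply: fsup_ub; exists lo.
have upE p : a `&` RL_up psi p = val (RL_up phi p).
  apply: le_anti; apply/andP; split.
    rewrite U; apply: fsup_meet_le => _ [t pt ->].
    rewrite [X in X `&` _ <= _](updn _ _ pt) meetUl leUx leIl /=;
    apply: le_trans (le0x _).
    by rewrite meetC -(meet_pcompl (val (RL_dn phi t))) meetC leI2.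
  rewrite lexI down_valP andTb (RL_upE phi).
  apply: fsup_le => _ [_ [t pt ->] <-]; apply: le_trans (upV t) _.
  by rewrite U; apply: fsup_ub; exists t.
have dnE q : a `&` RL_dn psi q = val (RL_dn phi q).
  apply: le_anti; apply/andP; split.
    rewrite D; apply: fsup_meet_le => _ [t tq ->].
    rewrite [X in X `&` _ <= _](updn _ _ tq) meetUl leUx leIl andbT;
    apply: le_trans (le0x _).
    by rewrite -(meet_pcompl (V t)) leI2.
  rewrite lexI down_valP andTb (RL_dnE phi).
  apply: fsup_le => _ [_ [t tq ->] <-].
  apply: (@le_trans _ _ (pcompl (V t))); last by rewrite D; apply: fsup_ub; exists t.
  apply: le_pcompl; apply: le_anti; rewrite le0x andbT.
  by rewrite -(meet_pcompl (val (RL_dn phi t))) leI2.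
have gE p q : phi (LR_gen p q) = down_proj a (psi (LR_gen p q)).
  by apply: val_inj; rewrite !RL_genE down_valI -upE -dnE /= meetACA meetxx.
exists psi => u; rewrite (LR_fsup_gen u) !fmorph_sup; congr fsup.
rewrite eqEsubset; split=> [_ [_ [p [q [upq ->]]] <-]|_ [_ [_ [p [q [upq ->]]] <-] <-]].
  by rewrite gE; exists (psi (LR_gen p q)) => //; exists (LR_gen p q) => //; exists p, q.
by exists (LR_gen p q); [exists p, q|exact: gE].
Qed.

End Extension.

(** * [PF]-frames, essential [P]-frames and [F]-frames *)

Section Classes.
Context {d : Order.disp_t} {L : frameType d}.
Implicit Types (a b : L) (p q r s t : rat).

(** Meeting [a] and [b] with the complement of their meet makes them disjoint; joining the
    complemented meet back on preserves complementedness. *)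
Lemma PF_complementedI :
  PF_frame L <-> forall a b, Coz a -> Coz b -> complemented (a `&` b) ->
                   complemented a \/ complemented b.
Proof.
split=> [PF a b Ca Cb cab|h a b Ca Cb ab0]; last first.
  by apply: h => //; rewrite ab0; exact: complemented0.
have Cc := Coz_complemented (complemented_pcompl cab).
have split_compl x : a `&` b <= x ->
    complemented (x `&` pcompl (a `&` b)) -> complemented x.
  move=> abx cx; rewrite -[x]meetx1 -cab meetUr [x `&` (a `&` b)](meet_idPr abx).
  exact: complementedU.
have [] := PF _ _ (CozI Ca Cc) (CozI Cb Cc); first by rewrite meetACA meetxx meet_pcompl.
- by move=> /split_compl ca; left; apply: ca; exact: leIl.
- by move=> /split_compl cb; right; apply: cb; exact: leIr.
Qed.

(** [u] and [v] are [|f| > |g|] and [|g| > |f|], for [a = coz f], [b = coz g]. *)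
Lemma Coz_normal a b : Coz a -> Coz b -> a `|` b = \top ->
  exists u v, [/\ Coz u, Coz v, u `&` v = \bot, a `|` v = \top & b `|` u = \top].
Proof.
move=> [f _ <-] [g _ <-] ab1.
have half (h k : RL L) : coz h `|` coz k = \top ->
    coz h `|` RL_up (k * k - h * h)%R 0 = \top.
  move=> hk1; apply: le_anti; rewrite lex1 -hk1 leUx leUl /=.
  rewrite -(RL_up_sqr k) -(RL_up_sqr h) joinC.
  by apply: le_trans (RL_upD _ _); rewrite subrK.
exists (RL_up (f * f - g * g)%R 0), (RL_up (g * g - f * f)%R 0); split.
- exact: Coz_up.
- exact: Coz_up.
- by rewrite -[X in RL_up X 0 `&` _]opprB RL_upN meetC RL_up_dn0.
- exact: half.
- by apply: half; rewrite joinC.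
Qed.

(** Normality supplies disjoint [u] and [v], so the meets of [a] with [v] and of [b] with [u] are
    disjoint. If the first is complemented, so is [a], because [a] and [v] cover; likewise for
    [b]. *)
Lemma PF_essential : PF_frame L -> essential_P_frame L.
Proof.
move=> PF a b Ca Cb ab1; have [u [v [Cu Cv uv0 av1 bu1]]] := Coz_normal Ca Cb ab1.
have half (x y : L) : x `|` y = \top -> complemented (x `&` y) -> complemented x.
  move=> xy1 cxy; apply/complementedP; exists (pcompl (x `&` y) `&` y); split.
    by rewrite meetCA meetC meet_pcompl.
  rewrite joinIr xy1 meetx1; apply: le_anti; rewrite lex1 -cxy joinC /=.
  by rewrite [in leRHS]joinC leU2 ?leIl.
have [] := PF _ _ (CozI Ca Cv) (CozI Cb Cu).
- by rewrite meetACA [v `&` u]meetC uv0 meetx0.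
- by left; exact: half av1 _.
- by right; exact: half bu1 _.
Qed.

Lemma PF_F : PF_frame L -> F_frame L.
Proof.
move=> PF a Ca; split=> [y|phi [lo [hi bphi]]].
  by exists (val y); apply: val_inj; apply/meet_idPr; exact: down_valP.
pose U t := val (RL_up phi t); pose D t := val (RL_dn phi t).
have Ua t : U t <= a by exact: down_valP.
have Da t : D t <= a by exact: down_valP.
have UD0 s t : s <= t -> U t `&` D s = \bot.
  by move=> st; rewrite -down_valI RL_up_dn0 // down_val0.
have UD1 s t : s < t -> U s `|` D t = a by move=> st; rewrite -down_valU RL_up_dn1.
have Uhi t : hi <= t -> U t = \bot.
  move=> hit; rewrite /U -[RL_up _ _]meetx1 -bphi RL_genE meetCA RL_up_dn0 //.
  by rewrite meetx0 down_val0.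
have Dlo t : t <= lo -> D t = \bot.
  move=> hit; rewrite /D -[RL_dn _ _]meet1x -bphi RL_genE meetAC RL_up_dn0 //.
  by rewrite meet0x down_val0.
have UleD t : U t <= pcompl (D t) by apply: le_pcompl; exact: UD0.
have D_le s t : s <= t -> D s <= D t.
  by move=> st; rewrite -down_leE; exact: RL_dn_le.
have U_le s t : s <= t -> U t <= U s.
  by move=> st; rewrite -down_leE; exact: RL_up_le.
have pcompl0 : pcompl (\bot : L) = \top.
  by apply: le_anti; rewrite lex1; apply: le_pcompl; rewrite meetx0.
have rbB x : rather_below (\bot : L) x by exists \top; rewrite meet0x join1x.
have [ca|nca] := pselect (complemented a).
  (* For complemented [a], the extension takes the constant value [hi] off [a]. *)
  apply: (@down_scale_extend _ _ a phi (fun t => if hi <= t then \bot else pcompl (D t))).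
  - move=> s t st; case: (leP hi t) => // thi.
    rewrite ifF; last by apply/negbTE; rewrite -ltNge; lra.
    exists (D t); rewrite meetC meet_pcompl; split=> //.
    apply: le_anti; rewrite lex1 /= -ca leUx; apply/andP; split.
      by rewrite -(UD1 _ _ st) joinC leU2.
    by apply: le_trans (leUr _ _); apply: pcompl_le.
  (* The index must be at most [lo], where [D] vanishes, and below [hi], to escape the
     truncation. *)
  - exists (Order.min lo (hi - 1)); rewrite Dlo ?ge_min ?lexx // pcompl0 ifF //.
    by apply/negbTE; rewrite -ltNge gt_min; apply/orP; right; lra.
  - by exists hi; rewrite lexx.
  - by move=> t; rewrite -/(U t); case: (leP hi t) => [/Uhi ->|_]; last exact: UleD.
  - by move=> t; case: (leP hi t).
have CU t : Coz (U t) by apply: Coz_down => //; exact: Coz_up.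
have CD t : Coz (D t) by apply: Coz_down => //; exact: Coz_dn.
have alt s t : s < t -> ~ complemented (U t) -> complemented (D s).
  by move=> st nU; have [|//|//] := PF _ _ (CU t) (CD s); apply: UD0; exact: ltW.
have nUD s t : s < t -> complemented (U s) -> ~ complemented (D t).
  by move=> st cU cD; apply: nca; rewrite -(UD1 _ _ st); exact: complementedU.
apply: (@down_scale_extend _ _ a phi
  (fun t => if `[< complemented (U t) >] then U t else pcompl (D t))).
(* If [U t] is not complemented, then [D m] is, hence [U s] is not, and the complemented
   [pcompl (D m)] separates the two levels. *)
- move=> s t st; have [m sm mt] : exists2 m : rat, s < m & m < t.
    by exists ((s + t) / 2%:R); lra.
  case: asboolP => [cUt|nUt].
    apply: rather_belowS (complemented_rather_below cUt) => //.
    case: asboolP => _; first by apply: U_le; exact: ltW.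
    by apply: le_trans (UleD t) _; apply: pcompl_le; apply: D_le; exact: ltW.
  case: asboolP => [cUs|_]; first by case: (nUD _ _ sm cUs (alt _ _ mt nUt)).
  apply: rather_belowS (complemented_rather_below (complemented_pcompl (alt _ _ mt nUt))).
    by apply: pcompl_le; apply: D_le; exact: ltW.
  by apply: pcompl_le; apply: D_le; exact: ltW.
(* As [D lo] is bottom, [U (lo - 1)] is all of [a], which is not complemented; so the second branch
   applies. *)
- exists (lo - 1); have D0 : D (lo - 1) = \bot by apply: Dlo; lra.
  have l1 : lo - 1 < lo by rewrite ltrBlDr ltrDl.
  case: asboolP => [cU|_]; last by rewrite D0.
  by case: nca; rewrite -(UD1 _ _ l1) Dlo // joinx0.
- by exists hi; rewrite Uhi // ifT //; apply/asboolP; exact: complemented0.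
- by move=> t; case: asboolP => _ //; exact: UleD.
- by move=> t; case: asboolP => _ //; exact: UleD.
Qed.

(** The separating elements come from extending to [L] the function on
    [downset (a `|` b)] that is [1] on [a] and [0] on [b]. *)
Lemma F_frame_separation a b : F_frame L -> Coz a -> Coz b -> a `&` b = \bot ->
  exists c e, [/\ Coz c, Coz e, c `|` e = \top, c `&` a = \bot & e `&` b = \bot].
Proof.
move=> FL Ca Cb ab0; set m := a `|` b.
pose A : downset m := Downset (leUl a b); pose B : downset m := Downset (leUr b a).
have AB0 : A `&` B = \bot by apply: val_inj; rewrite down_valI down_val0.
have AB1 : A `|` B = \top by apply: val_inj; rewrite down_valU.
have cA : complemented A by apply/complementedP; exists B.
pose V t : downset m := if t < 0 then \top else if t < 1 then A else \bot.
have [||| h [U D]] := @RL_scale _ _ V.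
- move=> s t st; rewrite /V; case: (ltP s 0) => s0.
    by exists \bot; rewrite meetx0 joinx1.
  rewrite ifF; last by apply/negbTE; rewrite -leNgt; lra.
  case: (ltP t 1) => t1; last by exists \top; rewrite meet0x join1x.
  by rewrite ifT; [exact: complemented_rather_below|lra].
- by apply: le_anti; rewrite lex1; apply: fsup_ub; exists (- 1).
- apply: le_anti; rewrite lex1 /=; apply: (@le_trans _ _ (pcompl (V 1))).
    by apply: le_pcompl; rewrite meetx0.
  by apply: fsup_ub; exists 1.
have [|k kh] := (FL m (CozU Ca Cb)).2 h.
  exists (- 1), 2%:R; apply: le_anti; rewrite lex1 /= RL_genE U D lexI.
  apply/andP; split.
    by apply: fsup_ub; exists (- 1 / 2%:R).
  apply: (@le_trans _ _ (pcompl (V 1))).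
    by apply: le_pcompl; rewrite meetx0.
  by apply: fsup_ub; exists 1.
(* The two rays overlap, so they cover; the first misses the value one taken on [a], the second the
   value zero taken on [b]. *)
exists (RL_dn k (2%:R / 3%:R)), (RL_up k (1 / 3%:R)); split.
- exact: Coz_dn.
- exact: Coz_up.
- by rewrite joinC RL_up_dn1.
- have -> : RL_dn k (2%:R / 3%:R) `&` a = val (RL_dn h (2%:R / 3%:R) `&` A).
    rewrite down_valI -(RL_dn_down _ kh) meetAC.
    by rewrite (meet_idPr (leUl a b : a <= m)) meetC.
  rewrite -(@down_val0 _ _ m); congr val; apply: le_anti; rewrite le0x andbT.
  rewrite -(RL_up_dn0 h (lexx (2%:R / 3%:R))) meetC leI2 //.
  by rewrite U; apply: fsup_ub; exists (3%:R / 4%:R).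
- have -> : RL_up k (1 / 3%:R) `&` b = val (RL_up h (1 / 3%:R) `&` B).
    rewrite down_valI -(RL_up_down _ kh) meetAC.
    by rewrite (meet_idPr (leUr b a : b <= m)) meetC.
  rewrite -(@down_val0 _ _ m) -AB0; congr val; apply: le_anti.
  rewrite AB0 le0x andbT -AB0.
  rewrite leI2 // U; apply: fsup_le => _ [t t0 ->]; rewrite /V ifF; last first.
    by apply/negbTE; rewrite -leNgt; lra.
  by case: (t < 1) => //; exact: le0x.
Qed.

(** Joining [a] and [b] with disjoint elements that cover gives a comaximal pair, and
    complementedness passes to a disjoint summand. *)
Lemma essential_F_PF : essential_P_frame L -> F_frame L -> PF_frame L.
Proof.
move=> eL FL a b Ca Cb ab0.
have [c [e [Cc Ce ce1 ca0 eb0]]] := F_frame_separation FL Ca Cb ab0.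
have [||] := eL _ _ (CozU Ca Cc) (CozU Cb Ce).
- by apply: le_anti; rewrite lex1 -ce1 leU2 ?leUr.
- by move=> cac; left; apply: complemented_disjointU cac; rewrite meetC.
- by move=> cbe; right; apply: complemented_disjointU cbe; rewrite meetC.
Qed.

End Classes.

(** * Translation into ideals of the ring of functions *)

Section Characterization.
Context {d : Order.disp_t} {L : frameType d}.
Implicit Types (f g : RL L) (I J : set (RL L)).

Local Open Scope ring_scope.

Lemma PF_regularP :
  PF_frame L <-> forall f g, f * g = 0 -> regular f \/ regular g.
Proof.
split=> [PF f g fg0|h _ _ [f _ <-] [g _ <-]].
  have [|cf|cg] := PF _ _ (Coz_coz f) (Coz_coz g); first by rewrite -cozM fg0 coz0.
    by left; exact/regularP.
  by right; exact/regularP.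
rewrite -cozM => /coz_eq0/h[/regularP|/regularP]; by [left|right].
Qed.

Lemma PF_regularM f g : PF_frame L -> regular (f * g) -> regular f \/ regular g.
Proof.
move=> /PF_complementedI PF /regularP; rewrite cozM => /PF[||/regularP|/regularP].
- exact: Coz_coz.
- exact: Coz_coz.
- by left.
- by right.
Qed.

(** If [I] has a non-regular element [f], then for every [g] in [J] the regular product [f * g]
    forces [g] to be regular. *)
Lemma PF_P_ideal I J : PF_frame L -> is_ideal I -> is_ideal J ->
  P_ideal (ideal_mul I J) -> P_ideal I \/ P_ideal J.
Proof.
move=> PF iI iJ PIJ.
have [rI|] := pselect (forall f, I f -> regular f).
  by left; exact: regular_P_ideal.
move=> /existsNP[f /not_implyP[If nf]]; right; apply: regular_P_ideal => // g Jg.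
have := P_ideal_regular (@RL_reduced _ L) PIJ (ideal_mul_in If Jg).
by move=> /(PF_regularM PF)[].
Qed.

Lemma P_ideal_PF :
  (forall I J, is_ideal I -> is_ideal J ->
     P_ideal (ideal_mul I J) -> P_ideal I \/ P_ideal J) -> PF_frame L.
Proof.
move=> h; apply/PF_regularP => f g fg0.
have [||| |] := h (principal_ideal f) (principal_ideal g).
- exact: principal_is_ideal.
- exact: principal_is_ideal.
- rewrite ideal_mul_principal fg0 principal_ideal0; split; last by left.
  by rewrite -principal_ideal0; exact: principal_is_ideal.
- move=> /(P_ideal_regular (@RL_reduced _ L))/(_ (principal_ideal_id f)); by left.
- move=> /(P_ideal_regular (@RL_reduced _ L))/(_ (principal_ideal_id g)); by right.
Qed.

Lemma PF_semiprime f g : PF_frame L -> regular (f * g) ->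
  principal_ideal (f * g) <> setT ->
  semiprime (principal_ideal f) \/ semiprime (principal_ideal g).
Proof.
move=> PF rfg nT; have [rf|rg] := PF_regularM PF rfg.
  exact: (regular_semiprimeU (@RL_reduced _ L)).
by rewrite or_comm; apply: (regular_semiprimeU (@RL_reduced _ L)); rewrite // mulrC.
Qed.

Lemma semiprime_PF :
  (forall f g, f * g = 0 ->
     semiprime (principal_ideal f) \/ semiprime (principal_ideal g)) -> PF_frame L.
Proof.
move=> h; apply/PF_regularP => f g /h[] sp; [left|right];
  by apply: (semiprime_regularP (@RL_reduced _ L) (@RL_cube_roots _ L)).
Qed.

(** Over the one-element frame the ring is zero and has no proper, hence no semiprime, ideal. *)
Hypothesis nontrivial : (\bot : L) <> \top.

Lemma zero_ideal_proper : [set 0] <> [set: RL L].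
Proof.
move=> e; have : [set 0] (1 : RL L) by rewrite e.
by move=> /(congr1 coz); rewrite coz0 coz1 => /esym.
Qed.

Lemma PF_semiprime0 f g : PF_frame L -> f * g = 0 ->
  semiprime (principal_ideal f) \/ semiprime (principal_ideal g).
Proof.
move=> PF fg0; apply: PF_semiprime; rewrite // fg0; first exact: regular0.
by rewrite principal_ideal0; exact: zero_ideal_proper.
Qed.

Lemma semiprime_zero_ideal : semiprime [set (0 : RL L)].
Proof.
rewrite -principal_ideal0; apply: (semiprime_regular (@RL_reduced _ L)).
  exact: regular0.
by rewrite principal_ideal0; exact: zero_ideal_proper.
Qed.

End Characterization.

(** * The cycle of implications *)

Theorem proposition5p4 (d : Order.disp_t) (L : frameType d)
    (nontrivial : (\bot : L) <> \top) (cregL : completely_regular L) :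
  [<->
    (* (1) *)
    PF_frame L;
    (* (2) *)
    forall a b : L, Coz a -> Coz b -> complemented (a `&` b) ->
      complemented a \/ complemented b;
    (* (3) *)
    forall I J : set (RL L), is_ideal I -> is_ideal J ->
      P_ideal (ideal_mul I J) -> P_ideal I \/ P_ideal J;
    (* (4), product *)
    forall f g : RL L,
      ideal_mul (principal_ideal f) (principal_ideal g) = [set 0] ->
      semiprime (principal_ideal f) \/ semiprime (principal_ideal g);
    (* (4), intersection *)
    forall f g : RL L,
      (principal_ideal f `&` principal_ideal g)%classic = [set 0] ->
      semiprime (principal_ideal f) \/ semiprime (principal_ideal g);
    (* (5), product *)
    forall f g : RL L,
      semiprime (ideal_mul (principal_ideal f) (principal_ideal g)) ->
      semiprime (principal_ideal f) \/ semiprime (principal_ideal g);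
    (* (5), intersection *)
    forall f g : RL L,
      semiprime (principal_ideal f `&` principal_ideal g)%classic ->
      semiprime (principal_ideal f) \/ semiprime (principal_ideal g);
    (* (6) *)
    essential_P_frame L /\ F_frame L ].
Proof.
have red := @RL_reduced _ L; have cbrt := @RL_cube_roots _ L.
tfae.
- by move/PF_complementedI.
- by move/PF_complementedI => PF I J; exact: PF_P_ideal.
- move/P_ideal_PF => PF f g; rewrite ideal_mul_principal => fg0.
  apply: PF_semiprime0 => //; have := principal_ideal_id (f * g)%R.
  by rewrite fg0.
- move=> h f g /(principal_ideal_cap0 red) fg0; apply: h.
  by rewrite ideal_mul_principal fg0 principal_ideal0.
- move=> h f g; rewrite ideal_mul_principal => sfg.
  have PF : PF_frame L.
    by apply: semiprime_PF => f' g' /(principal_ideal_cap0 red)/h.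
  apply: PF_semiprime => //; last by case: sfg => -[].
  exact: semiprime_regularP.
- move=> h f g sfg; have PF : PF_frame L.
    apply: semiprime_PF => f' g' fg0; apply: h.
    by rewrite ideal_mul_principal fg0 principal_ideal0; exact: semiprime_zero_ideal.
  apply: PF_semiprime => //; first exact: semiprime_capP.
  (* The ideal of [f * g] lies in the intersection, so it is proper because the intersection is. *)
  move=> fgT; case: sfg => -[_ nT] _; apply: nT; rewrite -subTset -fgT.
  by move=> _ [r _ <-]; split; [exists (r * g)%R|exists (r * f)%R] => //; ring.
- move=> h; have PF : PF_frame L.
    apply: semiprime_PF => f g /(principal_ideal_cap0 red) fg0; apply: h.
    by rewrite fg0; exact: semiprime_zero_ideal.
  by split; [exact: PF_essential|exact: PF_F].
- by case; exact: essential_F_PF.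
Qed.
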